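(* For every constant $\kappa>0$ there exists a constant $c=c(\kappa)>0$ such that the following holds. Let $G$ be a finite connected regular undirected graph with $|G|\ge 2$ vertices, and suppose that $H(G)\le \kappa\,|G|$. Then the $L^2$ mixing time of the lamplighter random walk on $G^{\lozenge}$ satisfies $$\tau_2(G^{\lozenge})\;\le\; c\,|G|\bigl(T_{rel}(G)+\log|G|\bigr).$$
   Context: $|G|$ denotes the number of vertices of $G$. The random walk on $G$ is the Markov chain whose transition matrix is the normalized adjacency matrix of $G$ (adjacency matrix divided by the degree); its stationary distribution is uniform. Maximal hitting time: $H(G)=\max_{x,y}\mathbb{E}_x[T_y]$, where $T_y$ is the first time the walk is at $y$ and $\mathbb{E}_x$ is expectation for the walk started at $x$. Relaxation time: $T_{rel}(G)=\max_\lambda \frac{1}{1-|\lambda|}$, the maximum being over the non-trivial eigenvalues of the normalized adjacency matrix (all eigenvalues, with multiplicity, except the simple eigenvalue $1$ of the constant functions), with $1/0=+\infty$ (so the bound is vacuous if $-1$ is an eigenvalue). Lamplighter graph and walk: a vertex of $G^{\lozenge}$ is a pair $(f,x)$ with $f:V(G)\to\{0,1\}$ (lamp configuration) and $x\in V(G)$ (lamplighter position). The lamplighter random walk is the Markov chain in which the lamplighter performs the random walk on $G$ while randomizing the lamps at visited vertices: in one step from $(f,x)$, a vertex $y$ is chosen according to the random walk on $G$ started from $x$, the lamplighter moves to $y$, and the lamps at $x$ and at $y$ are replaced by independent uniform random bits (one uniform bit if $y=x$), all other lamps being unchanged. Its stationary distribution $\pi$ is uniform. $L^2$ mixing time: for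 a Markov chain with transition matrix $P$ and stationary distribution $\pi$, $\tau_2$ is the least $n$ such that $\max_{z}\Bigl(\sum_{w}\bigl(P^n(z,w)/\pi(w)-1\bigr)^2\pi(w)\Bigr)^{1/2}\le 1/4$; $\tau_2(G^{\lozenge})$ is this quantity for the lamplighter random walk on $G^{\lozenge}$. *)

(* Defs.v *)
From HB Require Import structures.
From mathcomp Require Import all_boot all_order all_algebra.
From mathcomp Require Import all_classical all_reals all_analysis.

Set Implicit Arguments.
Unset Strict Implicit.
Unset Printing Implicit Defensive.

Import Order.TTheory GRing.Theory Num.Theory.

Local Open Scope classical_set_scope.
Local Open Scope ring_scope.

Section Graph.
Variables (V : finType) (e : rel V).

(* A loop contributes 1 to the degree, as it does to the row sum of the
   adjacency matrix. *)
Definition degree (x : V) : nat := #|[pred y | e x y]|.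

Definition regular : Prop := exists d : nat, forall x, degree x = d.

Definition connected_graph : Prop := forall x y, connect e x y.

Definition walk (R : realType) (x y : V) : R := (e x y)%:R / (degree x)%:R.

End Graph.

Section MarkovChain.
Variables (R : realType) (S : finType) (P : S -> S -> R).

Definition transition_mx : 'M[R]_#|S| :=
  \matrix_(i, j) P (enum_val i) (enum_val j).

Definition nstep (n : nat) (z w : S) : R :=
  (transition_mx ^+ n) (enum_rank z) (enum_rank w).

(* For s = [:: x_1; ...; x_n], the probability that the chain started at x
   satisfies X_1 = x_1, ..., X_n = x_n. *)
Fixpoint path_prob (x : S) (s : seq S) : R :=
  if s is y :: s' then P x y * path_prob y s' else 1.

(* P_x(T_y = n): the tuple t lists X_1, ..., X_n, and the index condition says
   that y occurs in X_0, ..., X_n for the first time at rank n (the index is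
   n.+1 when y does not occur). *)
Definition hit_prob (x y : S) (n : nat) : R :=
  \sum_(t : n.-tuple S | index y (x :: t) == n) path_prob x t.

(* E_x[T_y] for the variable T_y with values in nat and +oo; the last term is
   +oo * P_x(T_y = +oo), with the convention +oo * 0 = 0. *)
Definition expected_hitting_time (x y : S) : \bar R :=
  (\sum_(0 <= n <oo) (n%:R * hit_prob x y n)%:E
   + +oo * (1 - \sum_(0 <= n <oo) (hit_prob x y n)%:E))%E.

Definition max_hitting_time : \bar R :=
  \big[maxe/-oo%E]_(x : S) \big[maxe/-oo%E]_(y : S) expected_hitting_time x y.

(* Removing one factor 'X - 1 from the characteristic polynomial removes one
   copy of the eigenvalue 1, that of the constant functions. *)
Definition nontrivial_eigenvalue (l : R) : Prop :=
  root (char_poly transition_mx %/ ('X - 1%:P)) l.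

(* The supremum ranges over a finite set.  The inverse is that of \bar R, for
   which 0^-1 = +oo. *)
Definition relaxation_time : \bar R :=
  ereal_sup [set ((1 - `|l|)%:E^-1)%E | l in nontrivial_eigenvalue].

Definition l2_distance (pi : S -> R) (n : nat) (z : S) : R :=
  Num.sqrt (\sum_(w : S) (nstep n z w / pi w - 1) ^+ 2 * pi w).

(* Equal to +oo when no n qualifies. *)
Definition l2_mixing_time (pi : S -> R) : \bar R :=
  ereal_inf [set n%:R%:E | n in
    [set n : nat | \big[Num.max/0]_(z : S) l2_distance pi n z <= 4%:R^-1]].

End MarkovChain.

Definition uniform_dist (R : realType) (S : finType) (z : S) : R :=
  #|S|%:R^-1.

Section Lamplighter.
Variables (V : finType).

Definition lamp_state : finType := ({ffun V -> bool} * V)%type.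

(* Given the move from x to y, the new configuration is uniform among the
   2 ^ #|{x, y}| ones that agree with the old one off {x, y}. *)
Definition lamplighter (R : realType) (P : V -> V -> R) (u v : lamp_state) : R :=
  P u.2 v.2 * [forall z, (z \notin [set u.2; v.2]%SET) ==> (v.1 z == u.1 z)]%:R
    / (2 ^ #|[set u.2; v.2]%SET|)%:R.

End Lamplighter.

(* Main.v *)
Require Import Defs.
From HB Require Import structures.
From mathcomp Require Import all_boot all_order all_algebra.
From mathcomp Require Import all_classical all_reals all_analysis.
From mathcomp Require Import ring lra complex.

(* Write N = #|V| and let P be the walk.  The characters of the lamp group
   {0,1}^V split the lamplighter operator into the operators P_A, for A a subset
   of V, of the walk killed on A, so that the squared L2 distance after n steps
   equals N * (sum over A of P_A^(2n)(x, x)) - 1.  The term of the empty A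
   is controlled by the spectral gap.  For the others, (P_A)^(2n)(x, x) is at most
   exp (- 2 n lam) as soon as lam |f|^2 <= E(f) for all f vanishing on A, where
   E is the Dirichlet form.

   The function h = E_.[T_a] satisfies (I - P) h = 1 - N 1_a, so H <= k N gives
   (f(a) - mean f)^2 <= k E(f) for all f.  Hence the gap is at least
   gam = max (1 / T_rel, 1 / (k N)), and the Green function g of the walk killed
   at rate gam has g(a, a) <= 2 k and row sums 1 / gam <= T_rel.  Let B be a
   subset of A of maximal cardinality among those with
   sum_(B x B) g <= 6 k #|B|.  Then:
   - by duality, |f|^2 <= E(f) (12 k N / #|B| + 1 / gam) if f vanishes on B;
   - by maximality, A \ B is contained in the set of points a such that
     g(a, B) >= 2 k, of cardinality at most #|B| T_rel / (2 k).
   The choice of B costs a factor exp (#|B| log N) and that of A given B a factor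
   exp (O (#|B| T_rel)); both are absorbed by exp (- 2 n lam), which is at most
   exp (- c #|B| (T_rel + log N)) + exp (- c N) for n >= c' N (T_rel + log N). *)

Import Order.TTheory GRing.Theory Num.Theory.

Set Implicit Arguments.
Unset Strict Implicit.
Unset Printing Implicit Defensive.

Local Open Scope ring_scope.

(** * Spectral theorem for real symmetric matrices *)

Lemma char_poly_conj (F : fieldType) n (U D : 'M[F]_n) :
  U \in unitmx -> char_poly (invmx U *m D *m U) = char_poly D.
Proof.
move=> uU; rewrite /char_poly.
have -> : char_poly_mx (invmx U *m D *m U) =
    map_mx polyC (invmx U) *m char_poly_mx D *m map_mx polyC U.
  rewrite /char_poly_mx mulmxBr mulmxBl -!map_mxM; congr (_ - _).
  by rewrite mul_mx_scalar -scalemxAl -map_mxM mulVmx// map_mx1 scalemx1.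
rewrite !det_mulmx mulrAC -det_mulmx -map_mxM mulVmx// map_mx1 det1.
by rewrite mul1r.
Qed.

(** The complexification of [M] is Hermitian, hence unitarily diagonalizable with real eigenvalues.
    The factorization of the characteristic polynomial descends to [R] because the embedding into
    [R[i]] is injective. *)
Lemma real_symmetric_spectral (R : realType) n (M : 'M[R]_n) : M^T = M ->
  exists (U : 'M[R[i]]_n) (r : 'I_n -> R),
    [/\ U \is unitarymx,
        char_poly M = \prod_i ('X - (r i)%:P)
      & U *m map_mx (real_complex R) M =
        diag_mx (\row_i real_complex R (r i)) *m U].
Proof.
move=> sM; set Mc := map_mx _ M.
have hM : Mc \is hermsymmx.
  apply/is_hermitianmxP; rewrite expr0 scale1r.
  apply/matrixP => i j; rewrite !mxE -{1}sM mxE.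
  by apply/esym/CrealP; rewrite complex_real.
have /hermitian_normalmx /orthomx_spectralP := hM.
have /mxOverP := hermitian_spectral_diag_real hM.
set U := spectralmx _; set d := spectral_diag _ => dr eM.
have dE : d = \row_i real_complex R (complex.Re (d ord0 i)).
  by apply/rowP => i; rewrite mxE RRe_real// dr.
exists U, (fun i => complex.Re (d ord0 i)); split; first exact: spectral_unitarymx.
- apply: (map_poly_inj (real_complex R)).
  rewrite map_char_poly -/Mc {1}eM char_poly_conj ?spectral_unit//.
  rewrite char_poly_trig ?diag_mx_is_trig// rmorph_prod.
  apply: eq_bigr => i _; rewrite rmorphB /= map_polyX map_polyC /=.
  by rewrite {1}dE !mxE eqxx mulr1n.
- by rewrite {1}eM -dE !mulmxA mulmxV ?spectral_unit// mul1mx.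
Qed.

(** * Contraction on vectors of sum zero *)

Section SpectralContraction.

Local Open Scope sesquilinear_scope.

Lemma sum_sqr_norm_unitary (C : numClosedFieldType) n (U : 'M[C]_n)
    (v : 'cV[C]_n) :
  U \is unitarymx -> \sum_i `|(U *m v) i 0| ^+ 2 = \sum_i `|v i 0| ^+ 2.
Proof.
move=> uU.
have sqE (w : 'cV[C]_n) : \sum_i `|w i 0| ^+ 2 = (w ^t* *m w) 0 0.
  by rewrite mxE; apply: eq_bigr => i _; rewrite !mxE normCK mulrC.
rewrite !sqE trmx_mul map_mxM mulmxA -(mulmxA _ (U ^t*)) -invmx_unitary//.
by rewrite mulVmx ?unitarymx_unit// mulmx1.
Qed.

(** In an eigenbasis the constant vector is supported on a single index [i0], because every other
    eigenvalue has modulus at most [b < 1]. A vector of sum zero is orthogonal to it, so its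
    coordinate at [i0] vanishes and the others shrink by a factor at most [b]. *)
Lemma symmetric_contraction (R : realType) n (M : 'M[R]_n) (b : R) :
  M^T = M -> M *m const_mx 1 = const_mx 1 :> 'cV_n -> b < 1 ->
  (forall l, root (char_poly M %/ ('X - 1%:P)) l -> `|l| <= b) ->
  forall v : 'cV[R]_n, \sum_i v i 0 = 0 ->
  \sum_i ((M *m v) i 0) ^+ 2 <= b ^+ 2 * \sum_i (v i 0) ^+ 2.
Proof.
move=> sM M1 b1 rootM v v0.
have [U [r [uU chM eM]]] := real_symmetric_spectral sM.
have uU' := unitarymx_unit uU.
pose toC (w : 'cV[R]_n) := map_mx (real_complex R) w.
have coordM (w : 'cV[R]_n) i :
    (U *m toC (M *m w)) i 0 = real_complex R (r i) * (U *m toC w) i 0.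
  by rewrite /toC map_mxM mulmxA eM -mulmxA mul_diag_mx 2!mxE.
pose u : 'cV_n := U *m toC (const_mx 1).
have u_eig i : real_complex R (r i) * u i 0 = u i 0 by rewrite -coordM M1.
have one_sum (w : 'cV[R]_n) :
    real_complex R (\sum_i w i 0) = \sum_i (u i 0)^* * (U *m toC w) i 0.
  transitivity ((u ^t* *m (U *m toC w)) 0 0); last first.
    by rewrite [LHS]mxE; apply: eq_bigr => i _; rewrite !mxE.
  rewrite /u trmx_mul map_mxM mulmxA -(mulmxA _ (U ^t*)) -invmx_unitary//.
  rewrite mulVmx// mulmx1 mxE rmorph_sum; apply: eq_bigr => i _.
  by rewrite !mxE !rmorph1 mul1r.
have [i0 ui0 | u0] := pickP (fun i => u i 0 != 0); last first.
  suff n0 : n = 0%N by subst n; rewrite !big_ord0 mulr0.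
  have : u = 0 by apply/colP => i; rewrite [RHS]mxE; have /negbFE/eqP := u0 i.
  move=> /(congr1 (mulmx (invmx U))); rewrite mulKmx// mulmx0.
  move=> toC0; apply/eqP; rewrite -leqn0 leqNgt; apply/negP => n_gt0.
  have /colP/(_ (Ordinal n_gt0))/eqP := toC0.
  by rewrite !mxE rmorph1 oner_eq0.
have ri0 : r i0 = 1.
  apply: (@complexI R); apply: (mulIf ui0); by rewrite u_eig mul1r.
(* Dividing by ['X - 1] cancels the factor of index [i0] only, so all other indices, even those with
   eigenvalue 1, remain roots of the quotient. *)
have rootr i : i != i0 -> `|r i| <= b.
  move=> ii0; apply: rootM; rewrite chM (bigD1 i0)//= ri0 mulrC mulpK; last first.
    by rewrite polyXsubC_eq0.
  by rewrite (bigD1 i)//= rootM root_XsubC eqxx.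
have u_supp i : i != i0 -> u i 0 = 0.
  move=> ii0; apply/eqP/negPn/negP => ui.
  have := u_eig i; move=> /(canRL (mulfK ui)); rewrite divff// => /(@complexI R) ri.
  by have := rootr i ii0; rewrite ri normr1 leNgt b1.
have w_i0 : (U *m toC v) i0 0 = 0.
  have := one_sum v; rewrite v0 rmorph0 (bigD1 i0)//= big1 ?addr0; last first.
    by move=> i /u_supp ->; rewrite conjC0 mul0r.
  by move=> /esym/eqP; rewrite mulf_eq0 conjC_eq0 (negbTE ui0) /= => /eqP.
have normE (w : 'cV[R]_n) :
    real_complex R (\sum_i (w i 0) ^+ 2) = \sum_i `|(U *m toC w) i 0| ^+ 2.
  rewrite sum_sqr_norm_unitary// rmorph_sum; apply: eq_bigr => i _.
  by rewrite mxE normc_def /= expr0n addr0 sqrtr_sqr -[in RHS]rmorphXn real_normK ?num_real.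
suff : real_complex R (\sum_i ((M *m v) i 0) ^+ 2)
    <= real_complex R (b ^+ 2 * \sum_i (v i 0) ^+ 2) by rewrite lecR.
rewrite rmorphM /= !normE mulr_sumr; apply: ler_sum => i _.
rewrite coordM normrM exprMn.
have [->|ii0] := eqVneq i i0; first by rewrite w_i0 normr0 expr0n !mulr0.
apply: ler_wpM2r; first exact: exprn_ge0.
rewrite normc_def /= expr0n addr0 sqrtr_sqr -rmorphXn lecR.
by rewrite lerXn2r ?nnegrE// ?(le_trans _ (rootr i ii0)) ?rootr.
Qed.

End SpectralContraction.

(** * Kernels acting on functions *)

Section Kernels.
Variables (R : realType) (V : finType).
Implicit Types (P : V -> V -> R) (f g : V -> R).

Definition dot f g : R := \sum_x f x * g x.

Definition op P f : V -> R := fun x => \sum_y P x y * f y.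

Definition delta (x : V) : V -> R := fun y => (y == x)%:R.

(** The Dirichlet form of [P]. *)
Definition energy P f : R := dot f f - dot f (op P f).

Lemma dotC f g : dot f g = dot g f.
Proof. by apply: eq_bigr => x _; rewrite mulrC. Qed.

Lemma dot_ge0 f : 0 <= dot f f.
Proof. by apply: sumr_ge0 => x _; rewrite -expr2 sqr_ge0. Qed.

Lemma dotDl f g h (t : R) :
  dot (fun x => f x + t * g x) h = dot f h + t * dot g h.
Proof.
rewrite /dot mulr_sumr -big_split; apply: eq_bigr => x _ /=.
by rewrite mulrDl mulrA.
Qed.

Lemma dotDr f g h (t : R) :
  dot h (fun x => f x + t * g x) = dot h f + t * dot h g.
Proof. by rewrite dotC dotDl !(dotC h). Qed.

Lemma opD P f g (t : R) :
  op P (fun x => f x + t * g x) = (fun x => op P f x + t * op P g x).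
Proof.
apply/funext => x; rewrite /op mulr_sumr -big_split; apply: eq_bigr => y _ /=.
by rewrite mulrDr mulrCA.
Qed.

Lemma opZ P f (t : R) : op P (fun x => t * f x) = (fun x => t * op P f x).
Proof.
apply/funext => x; rewrite /op mulr_sumr; apply: eq_bigr => y _ /=.
by rewrite mulrCA.
Qed.

Lemma sum_delta x : \sum_y delta x y = 1.
Proof. by rewrite /delta (bigD1 x)//= eqxx big1 ?addr0// => y /negbTE ->. Qed.

Lemma sum_enum_val f : \sum_x f x = \sum_(i < #|V|) f (enum_val i).
Proof.
rewrite (reindex_onto enum_rank enum_val)/=; last by move=> i _; rewrite enum_valK.
by apply: eq_big => [x|x _]; rewrite enum_rankK ?eqxx.
Qed.

Lemma dot_delta x f : dot (delta x) f = f x.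
Proof.
rewrite /dot (bigD1 x)//= /delta eqxx mul1r big1 ?addr0// => y /negbTE ->.
by rewrite mul0r.
Qed.

Lemma op_sym P f g : (forall x y, P x y = P y x) -> dot (op P f) g = dot f (op P g).
Proof.
move=> sP; rewrite /dot /op.
under eq_bigr do rewrite mulr_suml.
rewrite exchange_big; apply: eq_bigr => y _; rewrite mulr_sumr.
by apply: eq_bigr => x _; rewrite sP mulrAC mulrC.
Qed.

Lemma iter_op_sym P n f g : (forall x y, P x y = P y x) ->
  dot (iter n (op P) f) g = dot f (iter n (op P) g).
Proof. by move=> sP; elim: n f => // n IH f; rewrite iterSr IH op_sym// -iterS. Qed.

(** By symmetry, half of the steps move to the other side of the pairing with [delta x]. *)
Lemma return_sqr_norm P n x : (forall x y, P x y = P y x) ->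
  iter n.*2 (op P) (delta x) x =
  dot (iter n (op P) (delta x)) (iter n (op P) (delta x)).
Proof. by move=> sP; rewrite -addnn iterD iter_op_sym// dot_delta. Qed.

Lemma nstep_iter P n z w : nstep P n z w = iter n (op P) (delta w) z.
Proof.
elim: n z => [|n IH] z; first by rewrite /nstep expr0 mxE (inj_eq enum_rank_inj).
rewrite /nstep exprS mxE iterS /op [RHS]sum_enum_val; apply: eq_bigr => i _.
by rewrite mxE enum_rankK -IH /nstep enum_valK.
Qed.

(** The contraction is assumed only along the orbit of [f], so that the lemma also serves for
    operators that contract only an invariant subspace. *)
Lemma iter_contraction (K : (V -> R) -> V -> R) (rho : R) f n :
  0 <= rho -> (forall k, dot (iter k.+1 K f) (iter k.+1 K f)
              <= rho ^+ 2 * dot (iter k K f) (iter k K f)) ->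
  dot (iter n K f) (iter n K f) <= rho ^+ n.*2 * dot f f.
Proof.
move=> rho0 H; elim: n => [|n IH]; first by rewrite expr0 mul1r.
apply: (le_trans (H n)).
have -> : rho ^+ n.+1.*2 = rho ^+ 2 * rho ^+ n.*2 by rewrite -exprD.
by rewrite -mulrA ler_wpM2l// sqr_ge0.
Qed.

Lemma norm_dot_op_le P f : (forall x y, 0 <= P x y) ->
  `|dot f (op P f)| <= dot (fun x => `|f x|) (op P (fun x => `|f x|)).
Proof.
move=> P0; apply: (le_trans (ler_norm_sum _ _ _)); apply: ler_sum => x _.
rewrite normrM; apply: ler_wpM2l => //.
apply: (le_trans (ler_norm_sum _ _ _)); apply: ler_sum => y _.
by rewrite normrM ger0_norm.
Qed.

(** The discriminant argument behind every Cauchy-Schwarz inequality below: a positive semidefinite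
    form is evaluated at [f + t h]. *)
Lemma cauchy_schwarz_quadratic (a b c : R) : 0 <= c ->
  (forall t, 0 <= a + 2 * b * t + c * t ^+ 2) -> b ^+ 2 <= a * c.
Proof.
rewrite le_eqVlt => /predU1P[<-|c0] H.
  have [->|b0] := eqVneq b 0; first by rewrite expr0n mulr0.
  (* At this [t] the affine function [a + 2 b t] equals -1. *)
  have := H (- (a + 1) / (2 * b)); rewrite mul0r addr0 mulrC divfK; last first.
    by rewrite mulf_neq0// pnatr_eq0.
  by lra.
have := H (- b / c).
have -> : a + 2 * b * (- b / c) + c * (- b / c) ^+ 2 = (a * c - b ^+ 2) / c.
  by field; rewrite gt_eqF.
by rewrite pmulr_lge0 ?invr_gt0// subr_ge0.
Qed.

(** Polarization: the forms at [P f + rho f] and [P f - rho f] differ by [4 rho |P f|^2], while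
    [rho] times the sum of the two squared norms is [2 rho (|P f|^2 + rho^2 |f|^2)]. *)
Lemma norm_of_quadratic_form P (rho : R) f :
  0 < rho -> (forall x y, P x y = P y x) ->
  (forall g, `|dot g (op P g)| <= rho * dot g g) ->
  dot (op P f) (op P f) <= rho ^+ 2 * dot f f.
Proof.
move=> rho0 sP H.
have := H (fun x => op P f x + rho * f x).
have := H (fun x => op P f x + (- rho) * f x).
rewrite !opD !dotDl !dotDr !ler_norml.
rewrite -(op_sym f (op P f))// (dotC (op P f) f).
set a := dot f f; set b := dot f (op P f); set c := dot (op P f) (op P f).
move=> /andP[h1 _] /andP[_ h2].
have : 4 * (rho * c) <= 4 * (rho * (rho ^+ 2 * a)) by rewrite expr2; lra.
by rewrite ler_pM2l ?ltr0n// ler_pM2l.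
Qed.

End Kernels.

(** * Symmetric stochastic kernels: Dirichlet form and spectral gap *)

Section Chain.
Variables (R : realType) (V : finType) (P : V -> V -> R).
Hypothesis Psym : forall x y, P x y = P y x.
Hypothesis Pge0 : forall x y, 0 <= P x y.
Hypothesis Psum : forall x, \sum_y P x y = 1.
Implicit Types f g : V -> R.

Lemma sum_op f : \sum_x op P f x = \sum_x f x.
Proof.
rewrite /op exchange_big; apply: eq_bigr => y _ /=.
by rewrite -mulr_suml (eq_bigr (P y)) ?Psum ?mul1r// => x _; rewrite Psym.
Qed.

Lemma op_cst (m : R) : op P (fun=> m) = (fun=> m).
Proof. by apply/funext => x; rewrite /op -mulr_suml Psum mul1r. Qed.

(** Since rows and columns of [P] sum to 1, the terms in [f x ^+ 2] and in [f y ^+ 2] each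
    contribute [dot f f]. Nonnegativity and invariance under constants follow. *)
Lemma energyE f : 2 * energy P f = \sum_x \sum_y P x y * (f x - f y) ^+ 2.
Proof.
have e1 : dot f f = \sum_x \sum_y P x y * (f x * f x).
  by apply: eq_bigr => x _; rewrite -mulr_suml Psum mul1r.
have e2 : dot f f = \sum_x \sum_y P x y * (f y * f y).
  rewrite e1 exchange_big; apply: eq_bigr => x _; apply: eq_bigr => y _ /=.
  by rewrite Psym.
have e3 : dot f (op P f) = \sum_x \sum_y P x y * (f x * f y).
  apply: eq_bigr => x _; rewrite mulr_sumr; apply: eq_bigr => y _.
  by rewrite mulrCA.
have -> : 2 * energy P f = dot f f + dot f f - (dot f (op P f) + dot f (op P f)).
  by rewrite /energy; ring.
rewrite {1}e1 e2 !e3 -!big_split -sumrB; apply: eq_bigr => x _ /=.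
rewrite -!big_split -sumrB; apply: eq_bigr => y _ /=.
by ring.
Qed.

Lemma energy_ge0 f : 0 <= energy P f.
Proof.
suff : 0 <= 2 * energy P f by rewrite pmulr_rge0.
rewrite energyE; apply: sumr_ge0 => x _; apply: sumr_ge0 => y _.
by rewrite mulr_ge0// sqr_ge0.
Qed.

Lemma energy_shift f (m : R) : energy P (fun x => f x - m) = energy P f.
Proof.
apply: (@mulfI _ 2); first by rewrite pnatr_eq0.
rewrite !energyE; apply: eq_bigr => x _; apply: eq_bigr => y _.
by congr (_ * _ ^+ 2); ring.
Qed.

Definition mean f : R := (\sum_x f x) / #|V|%:R.

Hypothesis V_gt0 : (0 < #|V|)%N.

Let N0 : #|V|%:R != 0 :> R. Proof. by rewrite pnatr_eq0 -lt0n. Qed.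

Lemma sum_sub_mean f : \sum_x (f x - mean f) = 0.
Proof. by rewrite sumrB sumr_const -[X in _ - X]mulr_natr divfK// subrr. Qed.

Lemma dot_sub_mean f :
  dot f f = dot (fun x => f x - mean f) (fun x => f x - mean f)
    + #|V|%:R * mean f ^+ 2.
Proof.
have -> : dot (fun x => f x - mean f) (fun x => f x - mean f) =
    \sum_x (f x * f x - 2 * mean f * f x + mean f ^+ 2).
  by apply: eq_bigr => x _; ring.
rewrite big_split sumrB/= -mulr_sumr sumr_const -mulr_natr /dot.
have -> : \sum_x f x = #|V|%:R * mean f by rewrite mulrC divfK.
by ring.
Qed.

(** Pythagoras: [P] fixes the constant part [1 / N] of [delta x] and keeps the remainder of sum
    zero. *)
Lemma return_decomposition x n :
  iter n.*2 (op P) (delta R x) x = #|V|%:R^-1 +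
    dot (iter n (op P) (fun y => delta R x y - #|V|%:R^-1))
        (iter n (op P) (fun y => delta R x y - #|V|%:R^-1)).
Proof.
have iterE k : iter k (op P) (fun y => delta R x y - #|V|%:R^-1) =
    fun y => iter k (op P) (delta R x) y + (-1) * #|V|%:R^-1.
  elim: k => [|k IH]; first by apply/funext => y; rewrite mulN1r.
  by rewrite iterS IH (opD _ _ (fun=> #|V|%:R^-1)) op_cst.
have sumE k : \sum_y iter k (op P) (delta R x) y = 1.
  by elim: k => [|k IH]; [exact: sum_delta|rewrite /= sum_op].
have meanE : mean (iter n (op P) (delta R x)) = #|V|%:R^-1.
  by rewrite /mean sumE mul1r.
rewrite return_sqr_norm// dot_sub_mean meanE iterE.
have -> : (fun y => iter n (op P) (delta R x) y + (-1) * #|V|%:R^-1) =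
  (fun y => iter n (op P) (delta R x) y - #|V|%:R^-1).
  by apply/funext => y; rewrite mulN1r.
by rewrite addrC expr2 mulrA divff// mul1r.
Qed.

Section Spectral.
Variable b : R.
Hypotheses (b_ge0 : 0 <= b) (b_lt1 : b < 1).
Hypothesis eigen_b : forall l, nontrivial_eigenvalue P l -> `|l| <= b.

Lemma op_contraction f : \sum_x f x = 0 ->
  dot (op P f) (op P f) <= b ^+ 2 * dot f f.
Proof.
move=> f0; pose v : 'cV[R]_#|V| := \col_i f (enum_val i).
have trM : (transition_mx P)^T = transition_mx P.
  by apply/matrixP => i j; rewrite !mxE Psym.
have opE (g : V -> R) i :
    (transition_mx P *m \col_j g (enum_val j)) i 0 = op P g (enum_val i).
  by rewrite mxE /op [RHS]sum_enum_val; apply: eq_bigr => j _; rewrite !mxE.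
have M1 : transition_mx P *m const_mx 1 = const_mx 1 :> 'cV_#|V|.
  apply/colP => i; rewrite -[X in _ *m X](_ : \col_j 1 = _); last first.
    by apply/colP => j; rewrite !mxE.
  by rewrite (opE (fun=> 1)) op_cst mxE.
have := @symmetric_contraction R _ _ b trM M1 b_lt1 eigen_b v.
have -> : \sum_i v i 0 = 0.
  by rewrite -[RHS]f0 [RHS]sum_enum_val; apply: eq_bigr => i _; rewrite mxE.
have -> : \sum_i (transition_mx P *m v) i 0 ^+ 2 = dot (op P f) (op P f).
  by rewrite /dot [RHS]sum_enum_val; apply: eq_bigr => i _; rewrite opE expr2.
have -> : \sum_i v i 0 ^+ 2 = dot f f.
  by rewrite /dot [RHS]sum_enum_val; apply: eq_bigr => i _; rewrite mxE expr2.
exact.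
Qed.

Lemma return_le x n :
  iter n.*2 (op P) (delta R x) x <= #|V|%:R^-1 + b ^+ n.*2.
Proof.
rewrite return_decomposition lerD2l; set g := fun y => _.
have g0 : \sum_x g x = 0.
  by have := sum_sub_mean (delta R x); rewrite /mean sum_delta mul1r.
have gn k : \sum_x iter k (op P) g x = 0 by elim: k => //= k IH; rewrite sum_op.
apply: (le_trans (iter_contraction n b_ge0 _)).
  by move=> k; rewrite iterS op_contraction.
rewrite ler_piMr ?exprn_ge0//.
(* At time 0 the decomposition gives [dot g g = 1 - 1 / N], which is at most 1. *)
have := return_decomposition x 0; rewrite /= -/g {1}/delta eqxx mulr1n => e1.
have : 0 <= #|V|%:R^-1 :> R by rewrite invr_ge0.
by lra.
Qed.

(** Cauchy-Schwarz turns the norm bound [|P f| <= b |f|] into the bound [b |f|^2] on the quadratic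
    form. *)
Lemma spectral_gap f : \sum_x f x = 0 -> (1 - b) * dot f f <= energy P f.
Proof.
move=> f0; have /ler_wpM2l := op_contraction f0.
have := @cauchy_schwarz_quadratic R (dot (op P f) (op P f)) (dot f (op P f)) (dot f f)
  (dot_ge0 f).
have H t : 0 <= dot (op P f) (op P f) + 2 * dot f (op P f) * t + dot f f * t ^+ 2.
  have := dot_ge0 (fun x => op P f x + t * f x).
  rewrite dotDl !dotDr (dotC (op P f) f); set X := _ + _; set Y := (X in _ -> 0 <= X).
  suff -> : X = Y by [].
  by rewrite /X /Y; ring.
move=> /(_ H) h1 /(_ (dot f f) (dot_ge0 f)) h2.
have : `|dot f (op P f)| <= b * dot f f.
  rewrite -ler_sqr ?nnegrE ?mulr_ge0 ?dot_ge0// real_normK ?num_real//.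
  rewrite (le_trans h1)// mulrC (le_trans h2)// exprMn -/(dot f f).
  by rewrite mulrCA expr2.
by move=> /ler_normlP[_]; rewrite /energy; lra.
Qed.

End Spectral.
End Chain.

(** * Hitting times *)

Section Hitting.
Variables (R : realType) (V : finType) (P : V -> V -> R).
Hypothesis Pge0 : forall x y, 0 <= P x y.
Hypothesis Psum : forall x, \sum_y P x y = 1.

Lemma path_prob_ge0 x s : 0 <= path_prob P x s.
Proof. by elim: s x => //= y s IH x; rewrite mulr_ge0. Qed.

Lemma hit_prob_ge0 x a n : 0 <= hit_prob P x a n.
Proof. by apply: sumr_ge0 => t _; exact: path_prob_ge0. Qed.

Lemma hit_prob0 x a : hit_prob P x a 0 = (x == a)%:R.
Proof.
rewrite /hit_prob big_mkcond (bigD1 [tuple])//= big1 ?addr0; last first.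
  by move=> t /negP[]; apply/eqP; exact: tuple0.
by case: (x == a).
Qed.

Lemma hit_probS x a n :
  hit_prob P x a n.+1 = if x == a then 0 else \sum_y P x y * hit_prob P y a n.
Proof.
rewrite /hit_prob big_mkcond /=.
case: eqVneq => [->|xa].
  by rewrite big1// => t _.
under [RHS]eq_bigr do rewrite mulr_sumr big_mkcond.
rewrite pair_bigA /= (reindex (fun p : V * n.-tuple V => [tuple of p.1 :: p.2]))/=.
  by apply: eq_bigr => -[y t] _ /=; rewrite eqSS.
exists (fun t => (thead t, [tuple of behead t])) => [[y t] _|t _] /=.
  by rewrite theadE; congr (_, _); exact: val_inj.
by rewrite [in RHS](tuple_eta t).
Qed.

Lemma sum_hit_prob_le1 x a n : \sum_(0 <= k < n) hit_prob P x a k <= 1.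
Proof.
elim: n x => [|n IH] x; first by rewrite big_geq.
rewrite big_nat_recl// hit_prob0.
case: eqVneq => [->|xa].
  by rewrite big1 ?addr0// => k _; rewrite hit_probS eqxx.
rewrite add0r; under eq_bigr do rewrite hit_probS (negbTE xa).
rewrite exchange_big -(Psum x) /=; apply: ler_sum => y _.
by rewrite -mulr_sumr ler_piMr.
Qed.

Local Open Scope ereal_scope.

(** If the hitting probabilities summed to less than 1, the term weighted by [+oo] would make the
    expectation infinite. *)
Lemma hitting_time_fin (B : R) x a : expected_hitting_time P x a <= B%:E ->
  \sum_(0 <= n <oo) (hit_prob P x a n)%:E = 1 /\
  \sum_(0 <= n <oo) (n%:R * hit_prob P x a n)%:E <= B%:E.
Proof.
rewrite /expected_hitting_time; set m := (X in X + _ <= _); set s := (X in 1 - X).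
have s0 : 0 <= s by apply: nneseries_ge0 => n _ _; rewrite lee_fin hit_prob_ge0.
have m0 : 0 <= m.
  by apply: nneseries_ge0 => n _ _; rewrite lee_fin mulr_ge0// hit_prob_ge0.
have s1 : s <= 1.
  apply: lime_le.
    by apply: is_cvg_nneseries => n _ _; rewrite lee_fin hit_prob_ge0.
  by apply: nearW => n; rewrite sumEFin lee_fin sum_hit_prob_le1.
have [s_lt1|] := ltP s 1.
  rewrite gt0_mulye ?sube_gt0//.
  by rewrite addey ?leye_eq// gt_eqF// (lt_le_trans _ m0)// ltNy0.
move=> le1s; have s1E : s = 1 by apply/eqP; rewrite eq_le s1.
by rewrite s1E subee// mule0 adde0; split.
Qed.

Lemma expected_hitting_time_le_max x a :
  expected_hitting_time P x a <= max_hitting_time P.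
Proof.
apply: (le_trans (le_bigmax -oo (expected_hitting_time P x) a)).
exact: (le_bigmax -oo (fun x => \big[maxe/-oo]_y expected_hitting_time P x y)).
Qed.

(** The function is [h x = E_x[T_a]], and its equation is the first-step decomposition of the series
    defining it. *)
Lemma hitting_function (B : R) a : max_hitting_time P <= B%:E ->
  exists h : V -> R, [/\ forall x, (0 <= h x <= B)%R, h a = 0%R
    & forall x, x != a -> (h x = 1 + op P h x)%R].
Proof.
move=> HB.
have H x := hitting_time_fin (le_trans (expected_hitting_time_le_max x a) HB).
pose m x := \sum_(0 <= n <oo) (n%:R * hit_prob P x a n)%:E.
have m0 x : 0 <= m x.
  by apply: nneseries_ge0 => n _ _; rewrite lee_fin mulr_ge0// hit_prob_ge0.
have mfin x : m x = (fine (m x))%:E.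
  rewrite fineK// ge0_fin_numE//.
  by have [_ /le_lt_trans->] := H x; rewrite ?ltry.
have mS x : m x = \sum_(0 <= n <oo) (n.+1%:R * hit_prob P x a n.+1)%:E.
  rewrite /m nneseries_recl//; last first.
    by move=> n _; rewrite lee_fin mulr_ge0// hit_prob_ge0.
  rewrite mul0r add0e.
  have := @nneseries_addn R (fun n => (n%:R * hit_prob P x a n)%:E) 1.
  move=> <-; last by move=> n; rewrite lee_fin mulr_ge0// hit_prob_ge0.
  by apply: eq_eseriesr => n _; rewrite addn1.
exists (fun x => fine (m x)); split.
- by move=> x; rewrite fine_ge0//= -lee_fin -mfin; case: (H x).
- rewrite mS eseries0// => n _ _; by rewrite hit_probS eqxx mulr0.
- move=> x xa; apply: EFin_inj; rewrite -mfin mS.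
  (* The weight [n + 1] is split into [n], which rebuilds the expectation from [y], and 1, which
     gives the total hitting probability, equal to 1. *)
  transitivity (\sum_(0 <= n <oo) \sum_y (P x y)%:E *
      ((n%:R * hit_prob P y a n)%:E + (hit_prob P y a n)%:E)).
    apply: eq_eseriesr => n _; rewrite hit_probS (negbTE xa) -natr1.
    under [RHS]eq_bigr do rewrite -EFinD -EFinM.
    rewrite sumEFin mulr_sumr; congr EFin; apply: eq_bigr => y _.
    by rewrite mulrCA mulrDl mul1r.
  have nneg y n : 0 <= (n%:R * hit_prob P y a n)%:E.
    by rewrite lee_fin mulr_ge0// hit_prob_ge0.
  have nneg' y n : 0 <= (hit_prob P y a n)%:E by rewrite lee_fin hit_prob_ge0.
  rewrite nneseries_sum; last first.
    move=> y n _; apply: mule_ge0; first by rewrite lee_fin.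
    by apply: adde_ge0; [exact: nneg|exact: nneg'] .
  transitivity (\sum_y (P x y * (fine (m y) + 1))%:E).
    apply: eq_bigr => y _; rewrite nneseriesZl; last by move=> n _; rewrite adde_ge0.
    by rewrite nneseriesD// (H y).1 EFinM EFinD -mfin.
  rewrite sumEFin; congr EFin; rewrite addrC -{2}(Psum x) -big_split /=.
  by apply: eq_bigr => y _; rewrite mulrDr mulr1.
Qed.

End Hitting.

(** * Hitting times and the Dirichlet form *)

Section HittingEnergy.
Variables (R : realType) (V : finType) (P : V -> V -> R).
Hypothesis Psym : forall x y, P x y = P y x.
Hypothesis Pge0 : forall x y, 0 <= P x y.
Hypothesis Psum : forall x, \sum_y P x y = 1.
Hypothesis V_gt0 : (0 < #|V|)%N.

(** Cauchy-Schwarz for the Dirichlet form between [f] and the hitting function [h] of [a]: the cross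
    term is [N (mean f - f a)], and the energy of [h] is [N mean h], at most [k N^2]. *)
Lemma hitting_energy (k : R) f a :
  (max_hitting_time P <= (k * #|V|%:R)%:E)%E ->
  (f a - mean f) ^+ 2 <= k * energy P f.
Proof.
move=> /(hitting_function Pge0 Psum a)[h [hB ha hE]].
have N0 : 0 < #|V|%:R :> R by rewrite ltr0n.
pose lap := fun x => h x - op P h x.
have lapE x : lap x = 1 - #|V|%:R * delta R a x.
  have off y : y != a -> lap y = 1 by move=> ya; rewrite /lap {1}hE// addrK.
  have [->|xa] := eqVneq x a; last by rewrite off// /delta (negbTE xa) mulr0 subr0.
  (* The value of [lap] at [a] is forced to be [1 - N], since [lap] is 1 elsewhere and sums to
     zero. *)
  have : \sum_x lap x = 0 by rewrite sumrB sum_op// subrr.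
  rewrite (bigD1 a)//= (eq_bigr (fun=> 1)) => [|y ya]; last exact: off.
  rewrite sumr_const (eq_card (B := predC1 a))// cardC1 /delta eqxx mulr1.
  by move/eqP; rewrite addr_eq0 => /eqP->; rewrite -{2}(prednK V_gt0) -natr1; ring.
have dot_lap g : dot g lap = #|V|%:R * (mean g - g a).
  rewrite /dot; under eq_bigr do rewrite lapE mulrBr mulr1 mulrCA.
  rewrite sumrB -mulr_sumr -/(dot _ _) dotC dot_delta mulrBr.
  by rewrite /mean mulrCA divff ?mulr1// gt_eqF.
have energy_h : energy P h <= k * #|V|%:R ^+ 2.
  have -> : energy P h = dot h lap.
    by rewrite /energy /dot -sumrB; apply: eq_bigr => x _; rewrite mulrBr.
  rewrite dot_lap ha subr0 expr2 mulrA mulrC ler_pM2r//.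
  rewrite /mean ler_pdivrMr//.
  have -> : k * #|V|%:R * #|V|%:R = \sum_(x : V) k * #|V|%:R.
    by rewrite sumr_const mulr_natr.
  by apply: ler_sum => x _; case/andP: (hB x).
have cross : dot f h - dot f (op P h) = #|V|%:R * (mean f - f a).
  by rewrite -dot_lap /dot -sumrB; apply: eq_bigr => x _; rewrite mulrBr.
have := @cauchy_schwarz_quadratic R (energy P f) (#|V|%:R * (mean f - f a))
  (energy P h) (energy_ge0 Psym Pge0 Psum h).
have Q t : 0 <= energy P f + 2 * (#|V|%:R * (mean f - f a)) * t + energy P h * t ^+ 2.
  have := energy_ge0 Psym Pge0 Psum (fun x => f x + t * h x).
  rewrite /energy opD !dotDl !dotDr -cross (dotC h f).
  rewrite -(op_sym h f Psym) (dotC (op P h)).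
  set X := _ - _; set Y := (X in _ -> 0 <= X).
  suff -> : X = Y by [].
  by rewrite /X /Y; ring.
move=> /(_ Q); rewrite exprMn => h1.
have h2 := le_trans h1 (ler_wpM2l (energy_ge0 Psym Pge0 Psum f) energy_h).
rewrite -sqrrN opprB -(ler_pM2l (exprn_gt0 2 N0)) (le_trans h2)//.
by rewrite le_eqVlt; apply/orP; left; apply/eqP; ring.
Qed.

End HittingEnergy.

(** * Green function and killed walks *)

Section Green.
Variables (R : realType) (V : finType) (P : V -> V -> R).
Hypothesis Psym : forall x y, P x y = P y x.
Hypothesis Pge0 : forall x y, 0 <= P x y.
Hypothesis Psum : forall x, \sum_y P x y = 1.
Hypothesis V_gt0 : (0 < #|V|)%N.
Variable gam : R.
Hypothesis gam_gt0 : 0 < gam.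

(** At a point where [u] is minimal, averaging by [P] cannot decrease [u], so the hypothesis there
    gives [gam * u x >= 0]. *)
Lemma maximum_principle (u : V -> R) :
  (forall x, 0 <= (1 + gam) * u x - op P u x) -> forall x, 0 <= u x.
Proof.
move=> H x0.
case: (arg_minP u (erefl : predT x0)) => x _ xmin.
apply: (le_trans _ (xmin x0 isT)).
have : u x <= op P u x.
  rewrite -[leLHS]mul1r -(Psum x) mulr_suml; apply: ler_sum => y _.
  by apply: ler_wpM2l => //; exact: xmin.
have := H x; rewrite mulrDl mul1r => h1 h2.
by rewrite -(pmulr_rge0 _ gam_gt0); lra.
Qed.

(** [g] is the inverse of [1 + gam - P]. A kernel element and its opposite are both nonnegative by
    the maximum principle, so the matrix is injective. *)
Lemma green_exists : exists g : V -> V -> R,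
  forall b x, (1 + gam) * g b x - op P (g b) x = delta R b x.
Proof.
pose M := (1 + gam)%:M - transition_mx P.
have opE (g : V -> R) i :
    (M *m \col_j g (enum_val j)) i 0 =
      (1 + gam) * g (enum_val i) - op P g (enum_val i).
  rewrite mulmxBl mul_scalar_mx !mxE; congr (_ - _).
  by rewrite /op [RHS]sum_enum_val; apply: eq_bigr => j _; rewrite !mxE.
have trM : M^T = M.
  apply/matrixP => i j; rewrite !mxE Psym eq_sym.
  by case: eqVneq => // ->.
have uM : M \in unitmx.
  rewrite -row_free_unit; apply: inj_row_free => v vM.
  have Mv : M *m v^T = 0 by rewrite -trM -trmx_mul vM trmx0.
  pose f x := v 0 (enum_rank x).
  have vE : v^T = \col_j f (enum_val j) by apply/colP => j; rewrite !mxE /f enum_valK.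
  have f0 x : (1 + gam) * f x - op P f x = 0.
    by rewrite -{2}(enum_rankK x) -[in X in _ * X](enum_rankK x) -opE -vE Mv mxE.
  have fge x : 0 <= f x by apply: maximum_principle => y; rewrite f0.
  have fle x : 0 <= - 1 * f x.
    apply: (maximum_principle (u := fun x => - 1 * f x)) => y.
    by rewrite (opZ P f) mulrCA -mulrBr f0 mulr0.
  apply/rowP => j; rewrite mxE; apply/eqP; rewrite eq_le.
  have := fle (enum_val j); have := fge (enum_val j).
  by rewrite /f enum_valK mulN1r oppr_ge0 => -> ->.
exists (fun b x => invmx M (enum_rank x) (enum_rank b)) => b x.
set g := fun x => _.
have -> : (1 + gam) * g x - op P g x = (M *m \col_j g (enum_val j)) (enum_rank x) 0.
  by rewrite opE enum_rankK.
have -> : \col_j g (enum_val j) = col (enum_rank b) (invmx M).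
  by apply/colP => j; rewrite !mxE /g enum_valK.
rewrite colE mulmxA mulmxV// mul1mx !mxE eqxx andbT /delta.
by rewrite (inj_eq enum_rank_inj).
Qed.

Variable g : V -> V -> R.
Hypothesis gE : forall b x, (1 + gam) * g b x - op P (g b) x = delta R b x.

Lemma green_ge0 b x : 0 <= g b x.
Proof. by apply: maximum_principle => y; rewrite gE /delta ler0n. Qed.

Lemma green_sum b : \sum_x g b x = gam^-1.
Proof.
have : \sum_x ((1 + gam) * g b x - op P (g b) x) = 1.
  by under eq_bigr do rewrite gE; exact: sum_delta.
rewrite sumrB -mulr_sumr sum_op// mulrDl mul1r addrC addKr => h.
by apply: (mulfI (lt0r_neq0 gam_gt0)); rewrite h divff// lt0r_neq0.
Qed.

Lemma dot_green f b : (1 + gam) * dot f (g b) - dot f (op P (g b)) = f b.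
Proof.
rewrite -[RHS]dot_delta dotC /dot mulr_sumr -sumrB; apply: eq_bigr => x _.
by rewrite -gE; ring.
Qed.

Lemma green_sym a b : g a b = g b a.
Proof.
rewrite -(dot_green (g a) b) -(dot_green (g b) a) (dotC (g a)).
by rewrite -(op_sym (g a)) // (dotC (op P (g a))).
Qed.

Definition green_energy (A : {set V}) : R := \sum_(a in A) \sum_(b in A) g b a.

(** Cauchy-Schwarz for the form [energy + gam |.|^2] between [f] and the potential [h] of [A]:
    pairing with [h] is summation over [A], and the form at [h] itself is [green_energy A]. *)
Lemma green_duality f (A : {set V}) :
  (\sum_(a in A) f a) ^+ 2 <= (energy P f + gam * dot f f) * green_energy A.
Proof.
pose h x := \sum_(b in A) g b x.
have form_h f' : (1 + gam) * dot f' h - dot f' (op P h) = \sum_(a in A) f' a.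
  have -> : op P h = fun x => \sum_(b in A) op P (g b) x.
    apply/funext => x; rewrite /op exchange_big; apply: eq_bigr => y _ /=.
    by rewrite mulr_sumr.
  under [RHS]eq_bigr do rewrite -dot_green.
  rewrite sumrB -mulr_sumr; congr (_ * _ - _).
    rewrite /dot exchange_big; apply: eq_bigr => x _; exact: mulr_sumr.
  rewrite /dot exchange_big; apply: eq_bigr => x _; exact: mulr_sumr.
have energy_gam_ge0 f' : 0 <= energy P f' + gam * dot f' f'.
  by rewrite addr_ge0 ?energy_ge0// mulr_ge0 ?dot_ge0// ltW.
have hh : energy P h + gam * dot h h = green_energy A.
  by rewrite /green_energy -form_h /energy; ring.
rewrite -hh; apply: cauchy_schwarz_quadratic => // t.
have := energy_gam_ge0 (fun x => f x + t * h x).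
rewrite /energy opD !dotDl !dotDr -form_h (dotC h f) -(op_sym h f)// (dotC (op P h)).
set X := _ + _; set Y := (X in _ -> 0 <= X).
suff -> : X = Y by [].
by rewrite /X /Y; ring.
Qed.

Variable k : R.
Hypothesis k_gt0 : 0 < k.
Hypothesis gap : forall f, \sum_x f x = 0 -> gam * dot f f <= energy P f.
Hypothesis loc : forall f a, (f a - mean f) ^+ 2 <= k * energy P f.
Hypothesis gam_ge : 1 <= k * gam * #|V|%:R.

(** With [f = g a], the form [F = energy P f + gam |f|^2] equals [f a]. Bounding [f a ^+ 2] by
    [2 (f a - mean f)^2 + 2 (mean f)^2] gives [F^2 <= 2 k F]; the mean is controlled through
    [gam_ge]. *)
Lemma green_diag_le a : g a a <= 2 * k.
Proof.
pose f := g a; pose F := energy P f + gam * dot f f.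
have FE : F = f a by rewrite -(dot_green f a) /F /energy -/f; ring.
have F0 : 0 <= F by rewrite FE green_ge0.
have mean_le : mean f ^+ 2 <= k * gam * dot f f.
  have : mean f ^+ 2 <= (k * gam * #|V|%:R) * mean f ^+ 2.
    by rewrite ler_peMl ?sqr_ge0.
  move=> /le_trans; apply; rewrite -mulrA ler_wpM2l//; first by rewrite mulr_ge0// ltW.
  by rewrite (dot_sub_mean V_gt0 f) lerDr dot_ge0.
have : F * F <= (2 * k) * F.
  have -> : F * F = (f a) ^+ 2 by rewrite FE expr2.
  have : (f a) ^+ 2 <= 2 * (f a - mean f) ^+ 2 + 2 * mean f ^+ 2.
    rewrite -subr_ge0.
    rewrite (_ : _ - _ = (f a - 2 * mean f) ^+ 2); first exact: sqr_ge0.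
    by ring.
  by have := loc f a; rewrite /F; lra.
have [F_gt0|F_le0 _] := ltP 0 F; first by rewrite ler_pM2r// FE.
by rewrite -/f -FE (le_trans F_le0)// mulr_ge0// ltW.
Qed.

(** The constant 6 makes maximality work: adding a point [a] with potential below [2 k] raises the
    energy by at most [2 k + 2 (2 k) = 6 k], and a singleton qualifies because [2 k <= 6 k]. *)
Lemma separated_subset (A : {set V}) : (0 < #|A|)%N ->
  exists B : {set V}, [/\ B \subset A, (0 < #|B|)%N, green_energy B <= 6 * k * #|B|%:R
    & forall a, a \in A -> a \notin B -> 2 * k <= \sum_(b in B) g b a].
Proof.
case/card_gt0P => a0 a0A.
pose Q (B : {set V}) := (B \subset A) && (green_energy B <= 6 * k * #|B|%:R).
have Q0 : Q [set a0]%SET.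
  rewrite /Q finset.sub1set a0A /green_energy !big_set1 cards1 mulr1 /=.
  by apply: (le_trans (green_diag_le a0)); rewrite ler_pM2r// ler_nat.
case: (@arg_maxnP _ [set a0]%SET Q (fun B => #|B|) Q0) => B /andP[BA PhiB] Bmax.
exists B; split => //.
  by have := Bmax _ Q0; rewrite cards1.
move=> a aA aB; rewrite leNgt; apply/negP => lt_a.
have QaB : Q (a |: B).
  rewrite /Q finset.subUset finset.sub1set aA BA /= cardsU1 aB natrD mulrDr mulr1.
  have -> : green_energy (a |: B) =
      g a a + 2 * (\sum_(b in B) g b a) + green_energy B.
    rewrite /green_energy big_setU1//= big_setU1//=.
    have -> : \sum_(i in B) \sum_(b in a |: B) g b i =
        \sum_(i in B) g i a + \sum_(i in B) \sum_(b in B) g b i.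
      rewrite -big_split; apply: eq_bigr => i _ /=.
      by rewrite big_setU1//= green_sym.
    by ring.
  by have := green_diag_le a; lra.
by have := Bmax _ QaB; rewrite /= cardsU1 aB add1n ltnn.
Qed.

(** Markov's inequality for the potential of [B], whose total mass is [#|B| / gam]. *)
Lemma clump_card (B : {set V}) :
  2 * k * #|[set a | 2 * k <= \sum_(b in B) g b a]%SET|%:R <= #|B|%:R / gam.
Proof.
have -> : #|B|%:R / gam = \sum_a \sum_(b in B) g b a.
  rewrite exchange_big /=; under eq_bigr do rewrite green_sum.
  by rewrite sumr_const mulr_natl.
set C := [set a | _]%SET.
rewrite (bigID (mem C)) /= -[leLHS]addr0 lerD//.
  rewrite mulr_natr -sumr_const; apply: ler_sum => a.
  by rewrite inE.
by apply: sumr_ge0 => a _; apply: sumr_ge0 => b _; exact: green_ge0.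
Qed.

(** The centred function [f'] is controlled by the gap. It equals [- mean f] on [B], so duality on
    [B] controls the mean. *)
Lemma vanishing_energy (B : {set V}) f : (0 < #|B|)%N ->
  green_energy B <= 6 * k * #|B|%:R -> (forall x, x \in B -> f x = 0) ->
  dot f f <= energy P f * (12 * k * #|V|%:R / #|B|%:R + gam^-1).
Proof.
move=> B0 PhiB fB; set m := mean f.
have B_gt0 : 0 < #|B|%:R :> R by rewrite ltr0n.
pose f' x := f x - m.
have gap' : gam * dot f' f' <= energy P f.
  by have := gap (sum_sub_mean V_gt0 f); rewrite energy_shift.
have E0 : 0 <= energy P f by exact: energy_ge0.
have sumB : \sum_(a in B) f' a = - (#|B|%:R * m).
  under eq_bigr => a aB do rewrite /f' fB// sub0r.
  by rewrite sumr_const mulNrn mulr_natl.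
(* By the gap, the form of [f'] is at most twice the energy, whence [m^2 <= 12 k energy / #|B|]. *)
have : (#|B|%:R * m) ^+ 2 <= 2 * energy P f * (6 * k * #|B|%:R).
  rewrite -sqrrN -sumB (le_trans (green_duality f' B))//.
  rewrite /f' energy_shift// -/m -/f'.
  apply: ler_pM => //; last by lra.
  - by rewrite addr_ge0// mulr_ge0 ?dot_ge0// ltW.
  - apply: sumr_ge0 => a _; apply: sumr_ge0 => b _; exact: green_ge0.
have -> : 2 * energy P f * (6 * k * #|B|%:R) = #|B|%:R * (12 * k * energy P f) by ring.
rewrite exprMn expr2 -mulrA ler_pM2l// -ler_pdivlMl// => m_le.
rewrite (dot_sub_mean V_gt0 f) -/m -/f'.
have h1 : dot f' f' <= energy P f * gam^-1 by rewrite ler_pdivlMr// mulrC.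
have h2 := ler_wpM2l (ler0n R #|V|) m_le.
rewrite mulrDr addrC lerD//.
by apply: (le_trans h2); rewrite le_eqVlt; apply/orP; left; apply/eqP; ring.
Qed.

End Green.

(** * Return probabilities of the walk killed on a set *)

Section Killed.
Variables (R : realType) (V : finType) (P : V -> V -> R).
Hypothesis Psym : forall x y, P x y = P y x.
Hypothesis Pge0 : forall x y, 0 <= P x y.

(** Both endpoints must avoid [A]: this keeps the kernel symmetric and matches a lamplighter step,
    which randomizes the lamps at both ends. *)
Definition killed (A : {set V}) (x y : V) : R :=
  ((x \notin A) && (y \notin A))%:R * P x y.

(** The form of the killed kernel is bounded in absolute value, which controls negative eigenvalues
    too. Replacing [1 - lam] by [expR (- lam)] gives a positive rate, as [norm_of_quadratic_form]
    requires. *)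
Lemma killed_return_le (A : {set V}) (lam : R) x n :
  (forall f, (forall y, y \in A -> f y = 0) -> lam * dot f f <= energy P f) ->
  iter n.*2 (op (killed A)) (delta R x) x <= expR (- lam) ^+ n.*2.
Proof.
move=> H.
have ksym y z : killed A y z = killed A z y by rewrite /killed Psym andbC.
have form (f : V -> R) : `|dot f (op (killed A) f)| <= expR (- lam) * dot f f.
  (* Truncating [|f|] off [A] yields a test function admissible in [H]. *)
  pose f' y := (y \notin A)%:R * `|f y|.
  have f'f : dot f' f' <= dot f f.
    apply: ler_sum => y _; rewrite /f'; case: (y \in A) => /=.
      by rewrite !mul0r -expr2 sqr_ge0.
    by rewrite !mul1r -normrM ger0_norm// -expr2 sqr_ge0.
  have kge0 y z : 0 <= killed A y z by rewrite mulr_ge0.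
  apply: (le_trans (norm_dot_op_le f kge0)).
  have -> : dot (fun y => `|f y|) (op (killed A) (fun y => `|f y|)) =
      dot f' (op P f').
    apply: eq_bigr => y _; rewrite /op !mulr_sumr; apply: eq_bigr => z _.
    by rewrite /killed /f' -mulnb natrM; ring.
  have h0 : lam * dot f' f' <= energy P f'.
    by apply: H => y yA; rewrite /f' yA mul0r.
  have := expR_ge1Dx (- lam); have := dot_ge0 f'.
  move=> d0 e1; apply: (@le_trans _ _ ((1 - lam) * dot f' f')).
    by move: h0; rewrite /energy; lra.
  apply: (@le_trans _ _ (expR (- lam) * dot f' f')); first by apply: ler_wpM2r.
  by apply: ler_wpM2l => //; exact: expR_ge0.
rewrite return_sqr_norm//.
have -> : expR (- lam) ^+ n.*2 = expR (- lam) ^+ n.*2 * dot (delta R x) (delta R x).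
  by rewrite dot_delta /delta eqxx mulr1.
apply: iter_contraction => [|j]; first exact: expR_ge0.
by rewrite iterS; apply: norm_of_quadratic_form => //; exact: expR_gt0.
Qed.

End Killed.

(** * Lamplighter walk *)

Section LampCharacters.
Variables (R : realType) (V : finType) (P : V -> V -> R).
Hypothesis Psym : forall x y, P x y = P y x.
Hypothesis Psum : forall x, \sum_y P x y = 1.

Implicit Types (A D : {set V}) (f : {ffun V -> bool}).

(** The character of the group [{0,1}^V] indexed by the subset [A]. *)
Definition lamp_char A f : R := \prod_z (if z \in A then (-1) ^+ f z else 1).

Lemma lamp_char_sqr A f : lamp_char A f * lamp_char A f = 1.
Proof.
rewrite /lamp_char -big_split big1// => z _ /=.
by case: ifP; rewrite ?mulr1// -expr2 sqrr_sign.
Qed.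

(** The sum over [A] factors over the sites, and a site where the configurations differ contributes
    [1 - 1 = 0]. *)
Lemma lamp_char_orthogonality f f' :
  \sum_A lamp_char A f * lamp_char A f' = (2 ^ #|V|)%:R * (f' == f)%:R.
Proof.
transitivity (\prod_(z : V) ((-1) ^+ (f z (+) f' z) + 1 : R)).
  rewrite bigA_distr; apply: eq_bigr => A _.
  rewrite /lamp_char -big_split; apply: eq_bigr => z _ /=.
  by case: ifP; rewrite ?mulr1// signr_addb.
have [->|ff'] := eqVneq f' f.
  rewrite mulr1 (eq_bigr (fun=> 2)) => [|z _]; last by rewrite addbb.
  by rewrite prodr_const natrX.
rewrite mulr0; have [z fz] : exists z, f z != f' z.
  apply/existsP; apply: contraNT ff' => /existsPn H.
  by apply/eqP/ffunP => z; apply/esym/eqP/negPn/H.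
rewrite (bigD1 z)//= [X in X * _](_ : _ = 0) ?mul0r//.
by move: fz; case: (f z); case: (f' z) => //= _; rewrite expr1 addNr.
Qed.

(** Resampling the lamps of [D] kills a character that reads one of them and leaves the others
    unchanged; the sum factors over the sites. *)
Lemma lamp_char_average A D f :
  \sum_(f' : {ffun V -> bool})
     [forall z, (z \notin D) ==> (f' z == f z)]%:R * lamp_char A f' =
  (2 ^ #|D|)%:R * [disjoint A & D]%:R * lamp_char A f.
Proof.
pose F (z : V) (b : bool) : R :=
  (if z \in D then 1 else (b == f z)%:R) * (if z \in A then (-1) ^+ b else 1).
transitivity (\sum_(f' : {ffun V -> bool}) \prod_z F z (f' z)).
  apply: eq_bigr => f' _; rewrite big_split /=; congr (_ * _).
  case: forallP => [H|/forallP]; last first.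
    rewrite negb_forall => /existsP[z]; rewrite negb_imply => /andP[zD fz].
    by rewrite (bigD1 z)//= (negbTE zD) (negbTE fz) mul0r.
  rewrite big1// => z _; have := H z; case: (z \in D) => //= /eqP ->.
  by rewrite eqxx.
rewrite -(bigA_distr_bigA F) /=.
have FE z : \sum_b F z b = (if z \in D then 2 else 1) *
    (if (z \in A) && (z \in D) then 0 else 1) *
    (if z \in A then (-1) ^+ f z else 1).
  rewrite big_bool /F; case: (z \in D); case: (z \in A); case: (f z);
  rewrite /= ?expr1 ?expr0; ring.
under eq_bigr do rewrite FE.
rewrite !big_split /=; congr (_ * _ * _).
  by rewrite -big_mkcond prodr_const natrX.
case: (boolP [disjoint A & D]) => [dAD|/pred0Pn[z /andP[zA zD]]].
  rewrite big1// => z _; case: andP => // -[zA].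
  by rewrite (disjointFr dAD zA).
by rewrite (bigD1 z)//= (_ : (z \in A) && (z \in D)) ?mul0r//; apply/andP.
Qed.

(** A step from [x] to [y] resamples [{x, y}], so it preserves the character of [A] when both ends
    avoid [A] and annihilates it otherwise. *)
Lemma op_lamplighter A (u : V -> R) :
  op (lamplighter P) (fun w => lamp_char A w.1 * u w.2) =
  fun w => lamp_char A w.1 * op (killed P A) u w.2.
Proof.
apply/funext => -[f x] /=.
rewrite /op -(pair_bigA _ (fun f' y => lamplighter P (f, x) (f', y)
   * (lamp_char A f' * u y))) /= exchange_big mulr_sumr /=.
apply: eq_bigr => y _; rewrite /lamplighter /=.
set D := [set x; y]%SET.
transitivity (P x y / (2 ^ #|D|)%:R * u y *
   \sum_(f' : {ffun V -> bool})
     [forall z, (z \notin D) ==> (f' z == f z)]%:R * lamp_char A f').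
  by rewrite mulr_sumr; apply: eq_bigr => f' _; ring.
rewrite lamp_char_average.
have -> : [disjoint A & D] = (x \notin A) && (y \notin A).
  apply/pred0P/andP => [H|[xA yA] z] /=.
    by split; apply/negP => zA; [have := H x|have := H y]; rewrite /= zA !inE eqxx ?orbT.
  rewrite !inE; have [->|_] := eqVneq z x; first by rewrite (negbTE xA).
  by have [->|_] := eqVneq z y; rewrite ?(negbTE yA) ?andbF.
rewrite /killed; field.
by rewrite pnatr_eq0 expn_eq0.
Qed.

Lemma iter_op_sum (S I : finType) (K : S -> S -> R) n (c : I -> R) (F : I -> S -> R) :
  iter n (op K) (fun w => \sum_i c i * F i w) =
  fun w => \sum_i c i * iter n (op K) (F i) w.
Proof.
elim: n => //= n ->; apply/funext => w; rewrite /op.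
under [RHS]eq_bigr do rewrite mulr_sumr.
rewrite exchange_big; apply: eq_bigr => v _; rewrite mulr_sumr.
by apply: eq_bigr => i _; rewrite mulrCA.
Qed.

(** Expand the point mass in characters and evolve each component by its killed walk; at the
    starting configuration every character squares to 1. *)
Lemma lamplighter_return n f x :
  iter n (op (lamplighter P)) (delta R (f, x)) (f, x) =
  (2 ^ #|V|)%:R^-1 * \sum_A iter n (op (killed P A)) (delta R x) x.
Proof.
have dE : delta R (f, x) = fun w : lamp_state V => \sum_(A : {set V})
    ((2 ^ #|V|)%:R^-1 * lamp_char A f) * (lamp_char A w.1 * delta R x w.2).
  apply/funext => -[f' y] /=.
  transitivity ((2 ^ #|V|)%:R^-1 * delta R x y *
      \sum_(A : {set V}) lamp_char A f * lamp_char A f').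
    rewrite lamp_char_orthogonality mulrAC mulrA mulVf ?mul1r; last first.
      by rewrite pnatr_eq0 expn_eq0.
    by rewrite /delta xpair_eqE -natrM mulnb.
  by rewrite mulr_sumr; apply: eq_bigr => A _ /=; ring.
rewrite dE (@iter_op_sum (lamp_state V) {set V}) mulr_sumr.
apply: eq_bigr => A _; rewrite -mulrA; congr (_ * _).
have -> : iter n (op (lamplighter P)) (fun w => lamp_char A w.1 * delta R x w.2) =
  fun w => lamp_char A w.1 * iter n (op (killed P A)) (delta R x) w.2.
  by elim: n => //= n ->; rewrite op_lamplighter.
by rewrite mulrA lamp_char_sqr mul1r.
Qed.

Lemma lamplighter_sym (w w' : lamp_state V) : lamplighter P w w' = lamplighter P w' w.
Proof.
rewrite /lamplighter Psym finset.setUC; congr (_ * _%:R / _).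
by congr (nat_of_bool _); apply: eq_forallb => z; rewrite eq_sym.
Qed.

(** The case of the trivial character, for which no killing takes place. *)
Lemma lamplighter_sum (w : lamp_state V) : \sum_w' lamplighter P w w' = 1.
Proof.
have := congr1 (fun F => F w) (op_lamplighter finset.set0 (fun=> 1)).
have c1 f : lamp_char finset.set0 f = 1 by rewrite /lamp_char big1// => z _; rewrite inE.
rewrite /= c1 mul1r {1}/op => e.
transitivity (\sum_w' lamplighter P w w' * (lamp_char finset.set0 w'.1 * 1)).
  by apply: eq_bigr => w' _; rewrite c1 !mulr1.
rewrite e /op -[RHS](Psum w.2); apply: eq_bigr => y _.
by rewrite /killed !inE mulr1 mul1r.
Qed.

End LampCharacters.

(** * L2 distance and return probabilities *)

Section L2.
Variables (R : realType) (S : finType) (K : S -> S -> R).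
Hypothesis Ksym : forall x y, K x y = K y x.
Hypothesis Ksum : forall x, \sum_y K x y = 1.

Lemma l2_distance_sqr n z :
  \sum_(w : S) (nstep K n z w / uniform_dist R w - 1) ^+ 2 * uniform_dist R w =
  #|S|%:R * iter n.*2 (op K) (delta R z) z - 1.
Proof.
have S0 : #|S|%:R != 0 :> R.
  by rewrite pnatr_eq0 -lt0n; apply/card_gt0P; exists z.
pose k w := iter n (op K) (delta R z) w.
have kE w : nstep K n z w = k w.
  by rewrite nstep_iter -dot_delta -iter_op_sym// dotC dot_delta.
have ksum : \sum_w k w = 1.
  rewrite /k; elim: (n) => [|m IH]; last by rewrite iterS sum_op.
  exact: sum_delta.
rewrite return_sqr_norm// -/k /uniform_dist.
transitivity (\sum_w (#|S|%:R * (k w * k w) - 2 * k w + #|S|%:R^-1)).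
  by apply: eq_bigr => w _; rewrite kE; field.
rewrite big_split sumrB /= -!mulr_sumr ksum sumr_const -(mulr_natr _^-1) mulVf//.
by rewrite -/(dot k k); ring.
Qed.

End L2.

(** * Mixing time *)

Section Numeric.
Variable R : realType.

Lemma expRN8_le : expR (- 8) <= 256%:R^-1 :> R.
Proof.
rewrite expRN lef_pV2 ?posrE ?expR_gt0 ?ltr0n//.
have -> : 256%:R = (1 + 1) ^+ 8 :> R by rewrite -[1 + 1]/(2%:R) -natrX.
rewrite -[8%R]mulr1 expRM_natl lerXn2r ?nnegrE ?expR_ge0 ?expR_ge1Dx//.
Qed.

Lemma natr_le_exp2 n : n%:R <= 2 ^+ n :> R.
Proof. by rewrite -natrX ler_nat ltnW// ltn_expl. Qed.

(** The ratio [r * expR (- b)] is at most [r / 256 <= 1], so its positive powers are at most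
    [r / 256]. *)
Lemma exp_geometric_le (r b : R) n : 0 <= r -> r <= 256%:R -> 8 <= b ->
  (0 < n)%N -> r ^+ n * expR (- (b * n%:R)) <= r / 256%:R.
Proof.
move=> r0 r1 b8 n0; rewrite -mulNr [- b * _]mulrC expRM_natl -exprMn.
have rb : 0 <= r * expR (- b) <= r / 256%:R.
  rewrite mulr_ge0 ?expR_ge0//=; apply: ler_wpM2l => //.
  by apply: le_trans expRN8_le; rewrite ler_expR lerN2.
have [rb0 rb1] := andP rb; rewrite (le_trans _ rb1)//.
rewrite -[leRHS]expr1 ler_wiXn2l//.
by rewrite (le_trans rb1)// ler_pdivrMr ?mul1r ?ltr0n.
Qed.

Lemma expr1D_le (q : R) n : 0 <= q -> 2 * n%:R * q <= 1 ->
  (1 + q) ^+ n <= 1 + 2 * n%:R * q.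
Proof.
move=> q0; elim: n => [|n IH]; first by rewrite expr0 mulr0 mul0r addr0.
rewrite -natr1 => nq; have {}IH : (1 + q) ^+ n <= 1 + 2 * n%:R * q.
  by apply: IH; lra.
rewrite exprSr (le_trans (ler_wpM2r _ IH))//; first by lra.
rewrite -subr_ge0.
rewrite (_ : _ - _ = q * (1 - 2 * n%:R * q)); last by ring.
by rewrite mulr_ge0//; lra.
Qed.

(* The two terms correspond to [S * j <= N] and to [N <= S * j]. *)
Lemma exp_rate_le (k S T l N j a t : R) :
  0 < k -> 0 < S -> S <= T -> 0 <= l -> 0 < N -> 0 < j -> 0 <= a ->
  a * (12 * k + 1) * N * (T + l) <= t ->
  expR (- (12 * k * N / j + S)^-1 * t) <=
    expR (- (a * N)) + expR (- (a * j * (T + l))).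
Proof.
move=> k0 S0 ST l0 N0 j0 a0 tE; set den := _ + S.
have T0 : 0 < T := lt_le_trans S0 ST.
have den0 : 0 < den by rewrite addr_gt0// divr_gt0// !mulr_gt0.
have k1 : 0 < 12 * k + 1 by rewrite addr_gt0// mulr_gt0.
have [SjN|NSj] := lerP (S * j) N.
  apply: (@le_trans _ _ (expR (- (a * j * (T + l))))); last first.
    by rewrite lerDr expR_ge0.
  rewrite ler_expR mulNr lerN2 [leRHS]mulrC ler_pdivlMr//.
  apply: le_trans tE.
  have : den <= (12 * k + 1) * N / j.
    by rewrite mulrDl mul1r mulrDl lerD2l ler_pdivlMr.
  have c0 : 0 <= a * j * (T + l) by rewrite !mulr_ge0 ?addr_ge0// ltW.
  move=> /(ler_wpM2l c0)/le_trans; apply; rewrite le_eqVlt; apply/orP; left.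
  by apply/eqP; field; rewrite gt_eqF.
apply: (@le_trans _ _ (expR (- (a * N)))); last by rewrite lerDl expR_ge0.
rewrite ler_expR mulNr lerN2 [leRHS]mulrC ler_pdivlMr//.
apply: le_trans tE.
have : den <= (12 * k + 1) * (T + l).
  rewrite mulrDl mul1r lerD//; last by lra.
  rewrite -mulrA ler_wpM2l//; first by rewrite mulr_ge0// ltW.
  rewrite ler_pdivrMr// (le_trans (ltW NSj))// ler_wpM2r//; first exact: ltW.
  lra.
have c0 : 0 <= a * N by rewrite mulr_ge0// ltW.
move=> /(ler_wpM2l c0)/le_trans; apply; rewrite le_eqVlt; apply/orP; left.
by apply/eqP; ring.
Qed.

End Numeric.

(** * Counting sets by their skeletons *)

Section Counting.
Variables (R : realType) (V : finType).

Lemma sum_expr_card (q : R) : \sum_(B : {set V}) q ^+ #|B| = (1 + q) ^+ #|V|.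
Proof.
transitivity (\prod_(z : V) (q + 1)); last by rewrite prodr_const addrC.
rewrite bigA_distr; apply: eq_bigr => B _.
by rewrite -big_mkcond prodr_const.
Qed.

Lemma card_le_fiber (s : {set V} -> {set V}) (U B : {set V}) :
  (forall A : {set V}, (0 < #|A|)%N -> s A = B -> A \subset U) ->
  (#|[pred A : {set V} | (0 < #|A|)%N && (s A == B)]| <= 2 ^ #|U|)%N.
Proof.
move=> H; rewrite -card_powerset; apply: subset_leq_card.
apply/fintype.subsetP => A; rewrite inE => /andP[A0 /eqP sA].
by rewrite powersetE; exact: H.
Qed.

(* Since [A \subset s A :|: C (s A)], a given value [B] of [s] is
   taken at most [2 ^ (#|B| + #|C B|)] times. *)
Lemma sum_skeleton_le (s C : {set V} -> {set V}) (w M q : R) :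
  0 <= w -> 0 <= M -> q = expR (1 + M) * w ->
  (forall A : {set V}, (0 < #|A|)%N ->
    [/\ (0 < #|s A|)%N, A \subset s A :|: C (s A) & #|C (s A)|%:R <= #|s A|%:R * M]) ->
  \sum_(A : {set V} | (0 < #|A|)%N) w ^+ #|s A| <= (1 + q) ^+ #|V| - 1.
Proof.
move=> w0 M0 qE Hs.
have q0 : 0 <= q by rewrite qE mulr_ge0// expR_ge0.
rewrite (partition_big s (fun B => (0 < #|B|)%N)); last by move=> A /Hs[].
have -> : (1 + q) ^+ #|V| - 1 = \sum_(B : {set V} | (0 < #|B|)%N) q ^+ #|B|.
  rewrite -sum_expr_card (bigD1 finset.set0)//= cards0 expr0. rewrite addrAC subrr add0r.
  by apply: eq_bigl => B; rewrite card_gt0.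
apply: ler_sum => B B0.
rewrite (eq_bigr (fun=> w ^+ #|B|)) => [|A /andP[_ /eqP ->]//].
rewrite sumr_const.
(* When [C B] is too large, no nonempty [A] satisfies [s A = B] and the inner sum is empty. *)
have [CB|CB] := lerP #|C B|%:R (#|B|%:R * M); last first.
  rewrite [X in _ *+ X]eq_card0 ?mulr0n ?exprn_ge0// => A.
  apply/negP => /andP[/Hs[_ _ +] /eqP sA].
  by rewrite sA leNgt CB.
rewrite qE exprMn -[leLHS]mulr_natl ler_wpM2r ?exprn_ge0//.
have le_card : (#|[pred A : {set V} | (0 < #|A|)%N && (s A == B)]| <= 2 ^ #|B :|: C B|)%N.
  by apply: card_le_fiber => A /Hs[_ + _] <-.
apply: (@le_trans _ _ (2 ^+ (#|B| + #|C B|))).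
  rewrite -natrX ler_nat (leq_trans le_card)// leq_exp2l//.
  by rewrite cardsU leq_subr.
apply: (@le_trans _ _ (expR 1 ^+ (#|B| + #|C B|))).
  by rewrite lerXn2r ?nnegrE ?expR_ge0//; have := @expR_ge1Dx R 1; lra.
rewrite -!expRM_natl ler_expR mulr1 natrD mulrDr mulr1.
by rewrite lerD2l.
Qed.

End Counting.

(** * Bound on the L2 distance of the lamplighter walk *)

Section LamplighterMixing.
Variables (R : realType) (V : finType) (P : V -> V -> R).
Hypothesis Psym : forall x y, P x y = P y x.
Hypothesis Pge0 : forall x y, 0 <= P x y.
Hypothesis Psum : forall x, \sum_y P x y = 1.
Hypothesis V_gt0 : (0 < #|V|)%N.
Variables k T : R.
Hypotheses (k_gt0 : 0 < k) (T_ge1 : 1 <= T).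
Hypothesis hit : (max_hitting_time P <= (k * #|V|%:R)%:E)%E.
Hypothesis eigen : forall l, nontrivial_eigenvalue P l -> `|l| <= 1 - T^-1.

Let N : R := #|V|%:R.
Let l : R := ln N.

Let N_gt0 : 0 < N. Proof. by rewrite ltr0n. Qed.
Let N_ge1 : 1 <= N. Proof. by rewrite ler1n. Qed.
Let T_gt0 : 0 < T. Proof. by rewrite (lt_le_trans _ T_ge1). Qed.
Let l_ge0 : 0 <= l. Proof. by rewrite ln_ge0. Qed.

(** The entry [1 / T] gives [gam^-1 <= T], and the entry [1 / (k N)] gives [1 <= k gam N]. *)
Let gam : R := Num.max T^-1 (k * N)^-1.

Let gam_gt0 : 0 < gam. Proof. by rewrite lt_max invr_gt0 T_gt0. Qed.

(** Each entry of the maximum is a gap: [1 / T] by the spectral bound, and [1 / (k N)] by summing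
    [hitting_energy] over all points. *)
Let gam_gap f : \sum_x f x = 0 -> gam * dot f f <= energy P f.
Proof.
move=> f0; rewrite /gam; case: (leP T^-1 (k * N)^-1) => _.
  rewrite ler_pdivrMl ?mulr_gt0//.
  have mean0 : mean f = 0 by rewrite /mean f0 mul0r.
  have -> : k * N * energy P f = \sum_(a : V) k * energy P f.
    by rewrite sumr_const -mulr_natr mulrAC.
  apply: ler_sum => a _; have := hitting_energy Psym Pge0 Psum V_gt0 f a hit.
  by rewrite mean0 subr0 expr2.
have b0 : 0 <= 1 - T^-1 by rewrite subr_ge0 invf_le1.
have b1 : 1 - T^-1 < 1 by rewrite ltrBlDr ltrDl invr_gt0.
by have := spectral_gap Psym Psum b0 b1 eigen f0; rewrite subKr.
Qed.

Let gam_ge : 1 <= k * gam * N.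
Proof.
rewrite mulrAC -ler_pdivrMl ?mulr_gt0// mulr1.
by rewrite /gam le_max lexx orbT.
Qed.

Let gamV_le : gam^-1 <= T.
Proof. by rewrite invf_ple ?posrE// /gam le_max lexx. Qed.

(** In [a (T + l)], the part [T / (2 k)] pays for the choice of [A] given its skeleton; the 9 pays
    for the powers of [N] and leaves a factor [expR (- 8)]. *)
Let a : R := 9 + (2 * k)^-1.

Let a_ge9 : 9 <= a. Proof. by rewrite lerDl invr_ge0 mulr_ge0// ltW. Qed.

Variable n : nat.
Hypothesis n_ge : a * (12 * k + 1) * N * (T + l) <= n.*2%:R.

(** [s A] is the separated subset of [A], and [C B] the set of points where the potential of [B] is
    at least [2 k]. Since [C] depends on the skeleton alone, the sets [A] with a given skeleton can
    be counted. *)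
Lemma killed_skeleton : exists s C : {set V} -> {set V},
  forall A : {set V}, (0 < #|A|)%N ->
    [/\ (0 < #|s A|)%N, A \subset s A :|: C (s A),
        #|C (s A)|%:R <= #|s A|%:R * (T / (2 * k))
      & forall x, iter n.*2 (op (killed P A)) (delta R x) x <=
          expR (- (a * N)) + expR (- (a * (T + l))) ^+ #|s A|].
Proof.
have [g gE] := green_exists Psym Pge0 Psum gam_gt0.
pose C (B : {set V}) := [set a | 2 * k <= \sum_(b in B) g b a]%SET.
have /choice[s sP] : forall A : {set V}, exists B : {set V}, (0 < #|A|)%N ->
    [/\ B \subset A, (0 < #|B|)%N, green_energy g B <= 6 * k * #|B|%:R
    & forall a, a \in A -> a \notin B -> 2 * k <= \sum_(b in B) g b a].
  (* The empty set is the default value when [A] is empty. *)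
  move=> A; have [A0|] := ltnP 0 #|A|; last by exists finset.set0.
  have loc f b : (f b - mean f) ^+ 2 <= k * energy P f.
    exact: (hitting_energy Psym Pge0 Psum V_gt0).
  have [B HB] := separated_subset Psym Pge0 Psum V_gt0 gam_gt0 gE k_gt0 loc gam_ge A0.
  by exists B.
exists s, C => A A0; have [sA s0 Phi far] := sP A A0.
have card_s : 0 < #|s A|%:R :> R by rewrite ltr0n.
split => //.
- apply/fintype.subsetP => b bA; rewrite !inE.
  by case: (boolP (b \in s A)) => //= /far; apply.
- have := clump_card Psym Pge0 Psum gam_gt0 gE k (s A).
  rewrite -/(C (s A)) => h.
  rewrite mulrA ler_pdivlMr ?mulr_gt0// mulrC (le_trans h)//.
  by rewrite ler_pM2l.
- move=> x; pose den := 12 * k * N / #|s A|%:R + gam^-1.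
  have den0 : 0 < den.
    by rewrite addr_gt0 ?invr_gt0// divr_gt0// !mulr_gt0.
  (* A function vanishing on [A] vanishes on [s A], so [vanishing_energy] provides the rate
     [den^-1]. *)
  apply: (le_trans (@killed_return_le _ _ _ Psym Pge0 A den^-1 x n _)).
    move=> f fA; rewrite ler_pdivrMl// [leRHS]mulrC.
    apply: (vanishing_energy Psym Pge0 Psum V_gt0 gam_gt0 gE gam_gap s0 Phi).
    by move=> y ys; apply: fA; apply: (fintype.subsetP sA).
  rewrite -!expRM_natl mulrC.
  have -> : #|s A|%:R * - (a * (T + l)) = - (a * #|s A|%:R * (T + l)) by ring.
  apply: exp_rate_le => //; first by rewrite invr_gt0.
  by rewrite (le_trans _ a_ge9).
Qed.

Lemma empty_term_le x :
  N * iter n.*2 (op (killed P finset.set0)) (delta R x) x <= 1 + 128%:R^-1.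
Proof.
have -> : killed P finset.set0 = P.
  by apply/funext => y; apply/funext => z; rewrite /killed !inE mul1r.
have b0 : 0 <= 1 - T^-1 by rewrite subr_ge0 invf_le1.
have b1 : 1 - T^-1 < 1 by rewrite ltrBlDr ltrDl invr_gt0.
have := return_le Psym Psum V_gt0 b0 b1 eigen x n.
move=> /(ler_wpM2l (ltW N_gt0))/le_trans; apply.
rewrite mulrDr mulfV ?gt_eqF// lerD2l.
(* This uses [1 - 1 / T <= expR (- 1 / T)] and [2 n >= 9 N T]. *)
have : (1 - T^-1) ^+ n.*2 <= expR (- (9 * #|V|%:R)).
  apply: (@le_trans _ _ (expR (- T^-1) ^+ n.*2)).
    by rewrite lerXn2r ?nnegrE ?expR_ge0// expR_ge1Dx.
  rewrite -expRM_natl ler_expR mulrN lerN2 ler_pdivlMr//.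
  apply: le_trans n_ge.
  have h1 : 9 <= a * (12 * k + 1).
    have a0 : 0 <= a by apply: le_trans a_ge9.
    by rewrite (le_trans a_ge9)// ler_peMr// lerDr mulr_ge0// ltW.
  apply: (@le_trans _ _ (a * (12 * k + 1) * N * T)).
    apply: ler_wpM2r; first exact: ltW.
    by apply: ler_wpM2r => //; exact: ltW.
  apply: ler_wpM2l; last by rewrite lerDl.
  by rewrite mulr_ge0 ?(le_trans _ h1)// ltW.
move=> /(ler_wpM2l (ltW N_gt0))/le_trans; apply.
apply: (@le_trans _ _ (2 ^+ #|V| * expR (- (9 * #|V|%:R)))).
  by rewrite ler_wpM2r ?expR_ge0 ?natr_le_exp2.
by apply: (le_trans (exp_geometric_le _ _ _ V_gt0)); lra.
Qed.

(** The terms [expR (- (a * N))], at most [2^N] in number, contribute at most [4 / 256]. The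
    skeleton terms contribute at most [N ((1 + q)^N - 1) <= 2 N^2 q <= 2 / 256]. *)
Lemma nonempty_terms_le x :
  N * (\sum_(A : {set V} | (0 < #|A|)%N)
    iter n.*2 (op (killed P A)) (delta R x) x) <= 64%:R^-1 + 128%:R^-1.
Proof.
have [s [C sC]] := killed_skeleton.
pose w := expR (- (a * (T + l))); pose M := T / (2 * k).
have M0 : 0 <= M by rewrite divr_ge0 ?mulr_ge0 ?ltW.
pose q := expR (1 + M) * w.
have q0 : 0 <= q by rewrite mulr_ge0 ?expR_ge0.
have Nq : N * (2 * N * q) <= 2 / 256%:R.
  (* Writing [N^2] as [expR (l + l)] puts all factors in one exponent, at most -8 because
     [T >= 1]. *)
  have -> : N * (2 * N * q) = 2 * (expR (l + l) * q).
    by rewrite expRD /l lnK ?posrE//; ring.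
  apply: ler_wpM2l => //; apply: le_trans (expRN8_le R).
  rewrite /q /w -!expRD ler_expR.
  have -> : a * (T + l) = M + 9 * T + 9 * l + (2 * k)^-1 * l by rewrite /a /M; ring.
  have kl : 0 <= (2 * k)^-1 * l by rewrite mulr_ge0// invr_ge0 mulr_ge0// ltW.
  by have := T_ge1; have := l_ge0; lra.
have Nq1 : 2 * N * q <= 1.
  have : 2 * N * q <= N * (2 * N * q).
    by rewrite ler_peMl// mulr_ge0// mulr_ge0// ltW.
  by move=> /le_trans; apply; apply: (le_trans Nq); lra.
apply: (@le_trans _ _ (N * (2 ^+ #|V| * expR (- (a * N)) + ((1 + q) ^+ #|V| - 1)))).
  apply: ler_wpM2l; first exact: ltW.
  apply: (@le_trans _ _ (\sum_(A : {set V} | (0 < #|A|)%N)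
      (expR (- (a * N)) + w ^+ #|s A|))).
    by apply: ler_sum => A /sC[_ _ _]; exact.
  rewrite big_split lerD//=.
    rewrite sumr_const -[leLHS]mulr_natl; apply: ler_wpM2r; first exact: expR_ge0.
    rewrite -natrX ler_nat -[in leqRHS]cardsT -card_powerset.
    apply: subset_leq_card; apply/fintype.subsetP => A _.
    by rewrite powersetE finset.subsetT.
  apply: (@sum_skeleton_le _ _ s C w M q) => //; first exact: expR_ge0.
  by move=> A /sC[].
rewrite mulrDr lerD//.
  apply: (@le_trans _ _ (4 ^+ #|V| * expR (- (a * N)))).
    rewrite mulrA; apply: ler_wpM2r; first exact: expR_ge0.
    have -> : 4 = 2 * 2 :> R by ring.
    rewrite exprMn; apply: ler_wpM2r; first exact: exprn_ge0.
    exact: natr_le_exp2.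
  have a8 : 8 <= a by apply: le_trans a_ge9; lra.
  by apply: (le_trans (exp_geometric_le _ _ a8 V_gt0)); lra.
apply: (@le_trans _ _ (N * (2 * N * q))); last by lra.
apply: ler_wpM2l; first exact: ltW.
by rewrite lerBlDl; exact: expr1D_le.
Qed.

Lemma lamplighter_l2_le z :
  l2_distance (lamplighter P) (uniform_dist R (S := lamp_state V)) n z <= 4%:R^-1.
Proof.
case: z => f x; rewrite /l2_distance l2_distance_sqr; first last.
- by move=> w; exact: lamplighter_sum.
- by move=> w w'; exact: lamplighter_sym.
rewrite lamplighter_return card_prod card_ffun card_bool natrM.
have e2 : (2 ^ #|V|)%:R != 0 :> R by rewrite pnatr_eq0 expn_eq0.
rewrite mulrA [_ * N]mulrC mulfK// -/N (bigD1 finset.set0)//= mulrDr.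
rewrite (eq_bigl (fun A : {set V} => (0 < #|A|)%N)) => [|A]; last by rewrite card_gt0.
have h0 := empty_term_le x; have h1 := nonempty_terms_le x.
(* The excess [1/128 + 1/64 + 1/128 = 1/32] is below [1/16]. *)
have -> : 4%:R^-1 = Num.sqrt (4%:R^-1 ^+ 2) :> R.
  by rewrite sqrtr_sqr ger0_norm.
by apply: ler_wsqrtr; lra.
Qed.

End LamplighterMixing.

(** * Nontrivial eigenvalues and the relaxation time *)

Section Eigenvalues.
Variables (R : realType) (V : finType) (P : V -> V -> R).
Hypothesis Psym : forall x y, P x y = P y x.
Hypothesis Pge0 : forall x y, 0 <= P x y.
Hypothesis Psum : forall x, \sum_y P x y = 1.
Hypothesis V2 : (2 <= #|V|)%N.

Let trM : (transition_mx P)^T = transition_mx P.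
Proof. by apply/matrixP => i j; rewrite !mxE Psym. Qed.

Lemma mul_row_transition (v : 'rV[R]_#|V|) x :
  (v *m transition_mx P) 0 (enum_rank x) =
  op P (fun y => v 0 (enum_rank y)) x.
Proof.
rewrite mxE /op [RHS]sum_enum_val; apply: eq_bigr => j _.
by rewrite mxE enum_rankK enum_valK Psym mulrC.
Qed.

Lemma root_char_poly1 : root (char_poly (transition_mx P)) 1.
Proof.
rewrite -eigenvalue_root_char; apply/eigenvalueP; exists (const_mx 1).
  apply/rowP => j; rewrite scale1r -[j]enum_valK mul_row_transition !mxE.
  rewrite /op -[RHS](Psum (enum_val j)); apply: eq_bigr => y _.
  by rewrite mxE mulr1.
apply/eqP => /rowP/(_ (Ordinal (ltnW V2)))/eqP.
by rewrite !mxE oner_eq0.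
Qed.

Lemma nontrivial_eigenvalue_exists : exists l, nontrivial_eigenvalue P l.
Proof.
have [_ [r [_ chE _]]] := real_symmetric_spectral trM.
have := root_char_poly1; rewrite /nontrivial_eigenvalue chE rootE horner_prod.
move=> /prodf_eq0[i0 _]; rewrite -rootE root_XsubC => /eqP ri0.
have [i ii0] : exists i : 'I_#|V|, i != i0.
  have : (0 < #|predC1 i0|)%N by rewrite cardC1 card_ord -subn1 subn_gt0.
  by case/card_gt0P => i; exists i.
exists (r i); rewrite (bigD1 i0)//= -ri0 mulrC mulpK ?polyXsubC_eq0//.
by rewrite (bigD1 i)//= rootM root_XsubC eqxx.
Qed.

(** For an eigenvector [f], [|l| |f|^2] is at most the form of [P] at [|f|], itself at most [|f|^2]
    since energies are nonnegative. *)
Lemma nontrivial_eigenvalue_le1 l : nontrivial_eigenvalue P l -> `|l| <= 1.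
Proof.
move=> rl; have : eigenvalue (transition_mx P) l.
  rewrite eigenvalue_root_char -(divpK (d := 'X - 1%:P) (p := char_poly _)).
    by rewrite rootM; apply/orP; left; exact: rl.
  by rewrite dvdp_XsubCl root_char_poly1.
case/eigenvalueP => v vM v0; pose f x := v 0 (enum_rank x).
have opf x : op P f x = l * f x by rewrite -mul_row_transition vM mxE.
have dot_gt0 : 0 < dot f f.
  rewrite lt_neqAle dot_ge0 andbT eq_sym; apply: contra_neq v0 => ff0.
  apply/rowP => j; rewrite mxE -[j]enum_valK -/(f _); apply/eqP.
  rewrite -sqrf_eq0; apply/eqP.
  have sq0 x : true -> 0 <= f x * f x by rewrite -expr2 sqr_ge0.
  by have := psumr_eq0P (fun x _ => sq0 x isT) ff0; rewrite expr2; apply.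
have := norm_dot_op_le f Pge0.
have -> : dot f (op P f) = l * dot f f.
  by rewrite /dot mulr_sumr; apply: eq_bigr => x _; rewrite opf mulrCA.
have := energy_ge0 Psym Pge0 Psum (fun x => `|f x|).
have -> : energy P (fun x => `|f x|) =
    dot f f - dot (fun x => `|f x|) (op P (fun x => `|f x|)).
  congr (_ - _); apply: eq_bigr => x _.
  by rewrite -normrM ger0_norm// -expr2 sqr_ge0.
rewrite subr_ge0 normrM (gtr0_norm dot_gt0) => h1 h2.
by have := le_trans h2 h1; rewrite ger_pMl.
Qed.

Lemma relaxation_time_fin : relaxation_time P = +oo%E \/
  exists T : R, [/\ relaxation_time P = T%:E, 1 <= T
    & forall l, nontrivial_eigenvalue P l -> `|l| <= 1 - T^-1].
Proof.
have [l0 Hl0] := nontrivial_eigenvalue_exists.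
have le_sup l : nontrivial_eigenvalue P l ->
    ((1 - `|l|)%:E^-1 <= relaxation_time P)%E.
  by move=> Hl; apply: ereal_sup_ubound; exists l.
have ge0 l : nontrivial_eigenvalue P l -> 0 <= 1 - `|l|.
  by move=> /nontrivial_eigenvalue_le1; rewrite subr_ge0.
case E : (relaxation_time P) => [T||]; last 2 first.
- by left.
(* The value [-oo] would require an empty family of eigenvalues. *)
- have := le_sup _ Hl0; rewrite E leeNy_eq inve_eqNy.
  by [].
right; exists T.
have inv_le l : nontrivial_eigenvalue P l -> 0 < 1 - `|l| /\ (1 - `|l|)^-1 <= T.
  move=> Hl; have := le_sup _ Hl; rewrite E inver.
  case: eqVneq => [|l_neq]; first by rewrite leye_eq.
  by rewrite lee_fin lt_neqAle eq_sym l_neq ge0.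
have T1 : 1 <= T.
  have [gt0 /(le_trans _)] := inv_le _ Hl0; apply.
  by rewrite invf_ge1// gerBl.
have T0 : 0 < T by exact: lt_le_trans T1.
split=> // l /inv_le[gt0 leT].
by rewrite lerBrDl -lerBrDr invf_ple.
Qed.

End Eigenvalues.

(** * The random walk on a connected regular graph *)

Section Walk.
Variables (R : realType) (V : finType) (e : rel V).
Hypotheses (esym : symmetric e) (econn : connected_graph e) (ereg : regular e).
Hypothesis V2 : (2 <= #|V|)%N.

Lemma walk_sym x y : walk e R x y = walk e R y x.
Proof. by case: ereg => d dE; rewrite /walk esym !dE. Qed.

Lemma walk_ge0 x y : 0 <= walk e R x y.
Proof. by rewrite divr_ge0. Qed.

(** A path from [x] to a second vertex starts with an edge at [x]. *)
Lemma degree_gt0 x : (0 < degree e x)%N.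
Proof.
have [y yx] : exists y, y != x.
  apply/existsP; rewrite -negb_forall; apply/negP => /forallP H.
  have : (#|V| <= 1)%N.
    by rewrite -(card1 x); apply: subset_leq_card; apply/fintype.subsetP => y _; exact: H.
  by rewrite leqNgt V2.
have /connectP[[|z p] /= ep yE] := econn x y; first by rewrite yE eqxx in yx.
by apply/card_gt0P; exists z; case/andP: ep.
Qed.

Lemma walk_sum x : \sum_y walk e R x y = 1.
Proof.
rewrite /walk -mulr_suml.
have -> : \sum_y (e x y)%:R = (degree e x)%:R :> R.
  rewrite /degree -sum1_card natr_sum [RHS]big_mkcond; apply: eq_bigr => y _.
  by rewrite inE; case: (e x y).
by rewrite divff// pnatr_eq0 -lt0n degree_gt0.
Qed.

End Walk.

Theorem theorem2 (R : realType) (kappa : R) (hkappa : 0 < kappa) :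
  exists c : R, 0 < c /\
    forall (V : finType) (e : rel V),
      symmetric e -> connected_graph e -> regular e -> (2 <= #|V|)%N ->
      (max_hitting_time (walk e R) <= (kappa * #|V|%:R)%:E)%E ->
      (l2_mixing_time (lamplighter (walk e R)) (uniform_dist R (S := lamp_state V))
         <= (c * #|V|%:R)%:E * (relaxation_time (walk e R) + (ln #|V|%:R)%:E))%E.
Proof.
pose c0 := (9 + (2 * kappa)^-1) * (12 * kappa + 1).
have c0_gt0 : 0 < c0.
  by rewrite mulr_gt0// addr_gt0 ?invr_gt0 ?mulr_gt0.
(* The added 1 absorbs rounding the time up to an integer, because [N (T + ln N) >= 1]. *)
exists (c0 + 1); split; first by rewrite addr_gt0.
move=> V e esym econn ereg V2 hit.
have Psym := walk_sym R esym ereg.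
have Pge0 := @walk_ge0 R V e.
have Psum := @walk_sum R V e econn V2.
have V_gt0 : (0 < #|V|)%N by apply: leq_trans V2.
have N1 : 1 <= #|V|%:R :> R by rewrite ler1n.
have cN_gt0 : 0 < (c0 + 1) * #|V|%:R by rewrite mulr_gt0 ?addr_gt0 ?ltr0n.
case: (relaxation_time_fin Psym Pge0 Psum V2) => [->|[T [-> T1 eig]]].
  (* An infinite relaxation time makes the right-hand side [+oo]. *)
  by rewrite addye// gt0_muley ?leey ?lte_fin.
pose b := c0 * #|V|%:R * (T + ln #|V|%:R).
have l0 : 0 <= ln #|V|%:R :> R by rewrite ln_ge0.
have T0 : 0 <= T by exact: le_trans T1.
have b0 : 0 <= b by rewrite mulr_ge0 ?addr_ge0// mulr_ge0// ltW.
have Tl1 : 1 <= #|V|%:R * (T + ln #|V|%:R).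
  by rewrite mulr_ege1// ler_wpDr.
pose n := (Num.truncn b).+1.
have nb : b <= n%:R by rewrite ltW// /n truncnS_gt.
have n_le : n%:R <= (c0 + 1) * #|V|%:R * (T + ln #|V|%:R).
  have -> : (c0 + 1) * #|V|%:R * (T + ln #|V|%:R) = b + #|V|%:R * (T + ln #|V|%:R).
    by rewrite /b; ring.
  by rewrite /n -natr1 lerD ?truncn_le.
rewrite -EFinD -EFinM; apply: (@le_trans _ _ (n%:R)%:E); last by rewrite lee_fin.
apply: ereal_inf_lbound; exists n => //=.
apply: bigmax_le => // z _; apply: (lamplighter_l2_le Psym Pge0 Psum V_gt0 hkappa T1 hit eig).
by rewrite -/b (le_trans nb)// ler_nat -addnn leq_addr.
Qed.
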